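(* Let $\alpha\in\left( \frac{\sqrt{33}-5}{2}, \sqrt{2}-1\right)$, and let $T:[\alpha,\alpha+1]\to[\alpha,\alpha+1]$, $T(x)=\frac{2}{x}-d_1(x)$ with $d_1(x)=\left\lfloor \frac{2}{x}-\alpha\right\rfloor$. Put $$A=\tfrac{\sqrt{33}-5}{2},\quad B=\sqrt{2}-1,\quad C=\tfrac{\sqrt{33}-3}{6},\quad D=2\sqrt{2}-2,\quad E=\tfrac{\sqrt{33}-3}{2},\quad F=\sqrt{2}.$$ Let $\Omega\subset[\alpha,\alpha+1]\times\mathbb{R}$ be the set of points $(x,y)$ with $\ell(x)\le y\le u(x)$, where (up to finitely many values of $x$) $$\ell(x)=\begin{cases}A & x\in(\alpha,T^2(\alpha+1))\\ B & x\in(T^2(\alpha+1),T(\alpha))\\ C & x\in(T(\alpha),\alpha+1)\end{cases}\qquad u(x)=\begin{cases}D & x\in(\alpha,T(\alpha+1))\\ E & x\in(T(\alpha+1),T^2(\alpha))\\ F & x\in(T^2(\alpha),\alpha+1).\end{cases}$$ Then the map $\mathcal{T}(x,y)=\left(T(x),\frac{2}{d_1(x)+y}\right)$ on $\Omega$ is a natural extension of $T$. Moreover, the density of the invariant measure of $T$ is given by $$f(x)=H\Big(\tfrac{D}{2+Dx}\mathbf{1}_{(\alpha,T(\alpha+1))}(x)+\tfrac{E}{2+Ex}\mathbf{1}_{(T(\alpha+1),T^2(\alpha))}(x)+\tfrac{F}{2+Fx}\mathbf{1}_{(T^2(\alpha),\alpha+1)}(x)-\tfrac{A}{2+Ax}\mathbf{1}_{(\alpha,T^2(\alpha+1))}(x)-\tfrac{B}{2+Bx}\mathbf{1}_{(T^2(\alpha+1),T(\alpha))}(x)-\tfrac{C}{2+Cx}\mathbf{1}_{(T(\alpha),\alpha+1)}(x)\Big),$$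 where the normalizing constant $H$ is given by $$H^{-1}=\log\left(\tfrac{1}{32}(3+2\sqrt{2})(7+\sqrt{33})(\sqrt{33}-5)^2\right)\approx 0.25 .$$
   Context: $T^n$ denotes the $n$-fold iterate of $T$, $\lfloor\cdot\rfloor$ the floor function, and $\mathbf{1}_S$ the indicator function of a set $S$. ''The invariant measure of $T$'' is the $T$-invariant probability measure on $[\alpha,\alpha+1]$ that is absolutely continuous with respect to Lebesgue measure. That $\mathcal{T}$ on $\Omega$ is a natural extension of $T$ means, in this setting: $\mathcal{T}:\Omega\to\Omega$ is almost surely (i.e. up to Lebesgue null sets) bijective, it preserves the probability measure on $\Omega$ with density $c\,\frac{2}{(2+xy)^2}$ ($c$ a normalizing constant), and $([\alpha,\alpha+1],T)$ with its invariant measure is a factor of this two-dimensional system via the projection $(x,y)\mapsto x$. *)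

(* Defs.v *)
From HB Require Import structures.
From mathcomp Require Import all_boot all_order all_algebra.
From mathcomp Require Import all_classical all_reals all_analysis.

Set Implicit Arguments.
Unset Strict Implicit.
Unset Printing Implicit Defensive.
Import Order.TTheory GRing.Theory Num.Theory.
Import numFieldNormedType.Exports.

Local Open Scope classical_set_scope.
Local Open Scope ring_scope.

(* The density [g] is only relevant up to [m]-null sets, so pointwise
   nonnegativity is not required. *)
Definition has_density d (X : measurableType d) (R : realType)
    (m : {measure set X -> \bar R}) (D : set X) (P : probability X R)
    (g : X -> R) : Prop :=
  m.-integrable D (EFin \o g) /\
  forall E : set X, measurable E ->
    P E = (\int[m]_(x in D `&` E) (g x)%:E)%E.

(* As [P] is carried by [D], [P E] is the measure of [D `&` E]. *)
Definition preserves d (X : measurableType d) (R : realType)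
    (P : probability X R) (D : set X) (f : X -> X) : Prop :=
  [/\ measurable D, P D = 1%E, measurable_fun D f
    & forall E : set X, measurable E -> P (D `&` f @^-1` E) = P E].

Section Map.
Variables (R : realType) (alpha : R).

Definition d1 (x : R) : int := Num.floor (2 / x - alpha).

Definition T (x : R) : R := 2 / x - (d1 x)%:~R.

Definition calT (z : R * R) : R * R := (T z.1, 2 / ((d1 z.1)%:~R + z.2)).

Definition acip (mu : probability (measurableTypeR R) R) : Prop :=
  preserves mu `[alpha, alpha + 1] T /\ mu `<< lebesgue_measure.

Definition is_the_invariant_measure
    (mu : probability (measurableTypeR R) R) : Prop :=
  acip mu /\
  forall nu : probability (measurableTypeR R) R, acip nu ->
    forall E : set (measurableTypeR R), measurable E -> nu E = mu E.

End Map.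

Section Region.
Variable R : realType.

Definition cA : R := (Num.sqrt 33 - 5) / 2.
Definition cB : R := Num.sqrt 2 - 1.
Definition cC : R := (Num.sqrt 33 - 3) / 6.
Definition cD : R := 2 * Num.sqrt 2 - 2.
Definition cE : R := (Num.sqrt 33 - 3) / 2.
Definition cF : R := Num.sqrt 2.

Variable alpha : R.
Local Notation T := (T alpha).

(* [S] is the finite set of exceptional values of [x]. *)
Definition lower_boundary (S : set R) (l : R -> R) : Prop :=
  forall x : R, ~ S x ->
    [/\ alpha < x < iter 2 T (alpha + 1) -> l x = cA,
        iter 2 T (alpha + 1) < x < T alpha -> l x = cB
      & T alpha < x < alpha + 1 -> l x = cC].

Definition upper_boundary (S : set R) (u : R -> R) : Prop :=
  forall x : R, ~ S x ->
    [/\ alpha < x < T (alpha + 1) -> u x = cD,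
        T (alpha + 1) < x < iter 2 T alpha -> u x = cE
      & iter 2 T alpha < x < alpha + 1 -> u x = cF].

Definition Omega (l u : R -> R) : set (R * R) :=
  [set z | alpha <= z.1 <= alpha + 1 /\ l z.1 <= z.2 <= u z.1].

Definition Hinv : R :=
  ln (1 / 32 * (3 + 2 * Num.sqrt 2) * (7 + Num.sqrt 33)
      * (Num.sqrt 33 - 5) ^+ 2).

Definition H : R := Hinv^-1.

Definition density (x : R) : R :=
  H * (cD / (2 + cD * x) * \1_`]alpha, T (alpha + 1)[%classic x
     + cE / (2 + cE * x) * \1_`]T (alpha + 1), iter 2 T alpha[%classic x
     + cF / (2 + cF * x) * \1_`]iter 2 T alpha, alpha + 1[%classic x
     - cA / (2 + cA * x) * \1_`]alpha, iter 2 T (alpha + 1)[%classic x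
     - cB / (2 + cB * x) * \1_`]iter 2 T (alpha + 1), T alpha[%classic x
     - cC / (2 + cC * x) * \1_`]T alpha, alpha + 1[%classic x).

End Region.

Section NaturalExtension.
Variable R : realType.

Definition leb2 :
    {measure set (measurableTypeR R * measurableTypeR R)%type -> \bar R} :=
  (@lebesgue_measure R \x @lebesgue_measure R)%E.

(* [c] is the normalizing constant: it is determined by [P] being a
   probability.  The last two clauses say that [fst] is a factor map onto the
   one-dimensional system. *)
Definition natural_extension (Om : set (R * R)) (TT : R * R -> R * R)
    (T : R -> R) (mu : probability (measurableTypeR R) R) : Prop :=
  (exists N : set (R * R),
     leb2.-negligible N /\ set_bij (Om `\` N) (Om `\` N) TT) /\
  (exists (c : R)
      (P : probability (measurableTypeR R * measurableTypeR R)%type R),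
    [/\ has_density leb2 Om P (fun z => c * (2 / (2 + z.1 * z.2) ^+ 2)),
        preserves P Om TT,
        forall z : R * R, Om z -> (TT z).1 = T z.1
      & forall E : set (measurableTypeR R), measurable E ->
          P (fst @^-1` E) = mu E]).

End NaturalExtension.

(* Main.v *)
Require Import Defs.
From HB Require Import structures.
From mathcomp Require Import all_boot all_order all_algebra.
From mathcomp Require Import all_classical all_reals all_analysis.
From mathcomp Require Import measurable_realfun.
From mathcomp Require Import ring lra.

Import Order.TTheory GRing.Theory Num.Theory.
Import numFieldNormedType.Exports.

Set Implicit Arguments.
Unset Strict Implicit.
Unset Printing Implicit Defensive.

Local Open Scope classical_set_scope.
Local Open Scope ring_scope.

(** The map [T] acts on [[alpha, alpha + 1]] by the four branches
    [x |-> 2 / x - k], [1 <= k <= 4]. The map on the plane acts on each branch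
    by a Moebius transformation in each coordinate, with inverse
    [branch_inv k : (x, y) |-> (2 / (k + x), 2 / y - k)]. Two facts make the
    density [2 / (2 + x y) ^+ 2] invariant on the region.

    The first is a change of variables: the product of the two Jacobians of
    [branch_inv k] is the factor by which the density changes
    ([integral_kernel_branch]). The second is that the images of the pieces of
    the region tile the region. Fix [x] and put [x_k = 2 / (k + x)]. The
    preimages of the fibre over [x], seen on the axis of [2 / y], are the
    intervals from [k + low x_k] to [k + upp x_k]; they fit together because
    [k + upp x_k = k + 1 + low x_(k + 1)] ([tile_step]). This equation holds
    because the upper heights exceed the lower ones by one ([E = A + 1] and
    [F = B + 1]) and because [2 / T^2 (alpha + 1) = 2 / T^2 alpha + 1]
    ([break_points_inv]): the two end points of the interval have orbits that
    merge, and the heights change simultaneously at [x_k] and [x_(k + 1)]. The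
    ends of the chain are matched by the relations in [heights]
    ([tile_top], [tile_bot]). Away from the countable set of points related to a
    break point or a height by [x |-> 2 / x] and [x |-> x + 1] this gives an
    honest bijection ([calT_bij]), and with the change of variables the
    invariance of the measure ([kmeasure_invariant]).

    The marginal on the first coordinate is computed by Tonelli's theorem
    ([kmeasure_marginal]) and gives the stated density. Its mass is a sum of six
    logarithms in which every factor depending on [alpha] cancels
    ([boundary_ratios], [density_integral_is]).

    There remains the uniqueness of the absolutely continuous invariant
    probability. The two parts of the Hahn decomposition of the difference of
    two such measures are invariant up to null sets, so it suffices that a set
    [B] mapped into itself is null or of full measure ([invariant_null]). If [B]
    is not of full measure, it misses part of every branch. For the densities
    [1 / (1 + v x) ^+ 2], which the branches permute up to a factor, compare the
    mass of an interval with the mass that [B] misses in it, up to an additive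
    error. The error is halved under each branch. An interval that contains no
    branch is cut into at most two pieces by the ends of the branches, and then
    the images of the pieces contain a branch or are not cut, so the error is
    halved in two steps even after a cut ([good_halve]). Hence [B] misses a fixed
    proportion of every interval ([uniformly_missed]), so it has no density
    point. *)

(** * Measures with a density *)

Lemma measurable_inv (R : realType) :
  measurable_fun [set: R] (GRing.inv : R -> R).
Proof.
have -> : [set: R] = [set 0] `|` ~` [set 0] by rewrite setUCr.
apply/measurable_funU => //; first exact: measurableC.
split; first exact: measurable_fun_set1.
apply: open_continuous_measurable_fun.
  exact/closed_openC/closed_eq.
by move=> x /set_mem /eqP x0; exact: inv_continuous.
Qed.

Lemma measurable_floor (R : realType) :
  measurable_fun [set: R] (fun x : R => (Num.floor x)%:~R : R).
Proof.
apply: nondecreasing_measurable => // x y xy.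
by rewrite ler_int; exact: le_floor.
Qed.

Section density_measure.
Local Open Scope ereal_scope.
Context d (X : measurableType d) (R : realType) (m : {measure set X -> \bar R}).
Variables (D : set X) (g : X -> R).
Hypotheses (mD : measurable D) (mg : measurable_fun setT g).
Hypothesis g0 : forall x, (0 <= g x)%R.

(** The proofs are arguments of the definition, so that it can carry a measure
    structure. *)
Definition dmeasure of measurable D & measurable_fun setT g &
    (forall x, (0 <= g x)%R) : set X -> \bar R :=
  fun E => \int[m]_(x in D `&` E) (g x)%:E.

Local Notation nu := (dmeasure mD mg g0).

Let dmeasure0 : nu set0 = 0.
Proof. by rewrite /dmeasure setI0 integral_set0. Qed.

Let dmeasure_ge0 E : 0 <= nu E.
Proof. by apply: integral_ge0 => x _; rewrite lee_fin. Qed.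

Let dmeasure_sigma_additive : semi_sigma_additive nu.
Proof.
move=> /= F mF tF mUF; rewrite /dmeasure; apply: cvg_toP.
  apply: ereal_nondecreasing_is_cvgn => k n kn.
  apply: lee_sum_nneg_natr => // i _ _.
  by apply: integral_ge0 => x _; rewrite lee_fin.
rewrite setI_bigcupr ge0_integral_bigcup; first by [].
- by move=> i; exact: measurableI.
- exact/measurable_EFinP/measurable_funTS.
- by move=> x _; rewrite lee_fin.
- exact: trivIset_setIl.
Qed.

HB.instance Definition _ := isMeasure.Build _ _ _ nu
  dmeasure0 dmeasure_ge0 dmeasure_sigma_additive.

Import HBNNSimple.

(** Integration against [g dm] is integration of the product against [m]: this
    holds for indicators by definition, hence for simple functions, hence in
    the limit. *)
Lemma ge0_integral_dmeasure (f : X -> \bar R) :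
  measurable_fun setT f -> (forall x, 0 <= f x) ->
  \int[nu]_x f x = \int[m]_(x in D) (f x * (g x)%:E).
Proof.
move=> mf f0; pose h := nnsfun_approx measurableT mf.
have mh n : measurable_fun setT (EFin \o h n).
  exact/measurable_EFinP/measurable_funP.
have mG : measurable_fun setT (EFin \o g) by exact/measurable_EFinP.
transitivity (limn (fun n => \int[nu]_x (h n x)%:E)).
  rewrite -monotone_convergence//=.
  - apply: eq_integral => x _; apply/esym/cvg_lim => //.
    exact: cvg_nnsfun_approx.
  - by move=> n x _; rewrite lee_fin.
  - by move=> x _ a b ab; rewrite lee_fin; exact/lefP/nd_nnsfun_approx.
transitivity (limn (fun n => \int[m]_(x in D) ((h n x)%:E * (g x)%:E)));
    last first.
  rewrite -monotone_convergence//=.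
  - apply: eq_integral => x _; apply/cvg_lim => //.
    by apply: cvgeZr => //; exact: cvg_nnsfun_approx.
  - move=> n; apply: measurable_funTS.
    exact: (emeasurable_funM (mh n) mG).
  - by move=> n x _; rewrite mule_ge0// lee_fin.
  - move=> x _ a b ab; rewrite lee_wpmul2r ?lee_fin//.
    exact/lefP/nd_nnsfun_approx.
congr (limn _); apply/funext => n.
have mr r : measurable (h n @^-1` [set r]).
  by rewrite -[_ @^-1` _]setTI; exact: measurable_funP.
transitivity (\sum_(r \in range (h n))
    \int[nu]_x (r * \1_(h n @^-1` [set r]) x)%:E).
  rewrite -ge0_integral_fsum//.
  - by apply: eq_integral => x _; rewrite fsumEFin// -fimfunE.
  - by move=> r; exact/measurable_EFinP/measurable_funM.
  - by move=> r x _; exact: nnfun_muleindic_ge0.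
transitivity (\sum_(r \in range (h n))
    \int[m]_(x in D) ((r * \1_(h n @^-1` [set r]) x)%:E * (g x)%:E)); last first.
  rewrite -ge0_integral_fsum//.
  - apply: eq_integral => x _; rewrite -ge0_mule_fsuml.
      by rewrite fsumEFin// -fimfunE.
    by move=> r; exact: nnfun_muleindic_ge0.
  - move=> r; apply: measurable_funTS.
    apply: (emeasurable_funM (g := EFin \o g)) => //.
    exact/measurable_EFinP/measurable_funM.
  - move=> r x _; apply: mule_ge0; last by rewrite lee_fin.
    exact: nnfun_muleindic_ge0.
apply: eq_fsbigr => r _.
rewrite integralZl_indic_nnsfun// integral_indic// setIT /=.
transitivity (\int[m]_(x in D) (r%:E * ((\1_(h n @^-1` [set r]) x)%:E * (g x)%:E))).
  have [r0|r0] := leP 0%R r; last first.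
    have -> : h n @^-1` [set r] = set0.
      by apply: preimage_nnfun0.
    rewrite measure0 mule0 integral0_eq// => x _.
    by rewrite indic0 mul0e mule0.
  rewrite ge0_integralZl//.
  - congr (_ * _); rewrite /dmeasure setIC integral_mkcondl; apply: eq_integral => x _.
    by rewrite patchE indicE; case: ifPn => _; rewrite ?mul1e ?mul0e.
  - apply: measurable_funTS.
    apply: (emeasurable_funM (g := EFin \o g)) => //.
    exact/measurable_EFinP/measurable_indic.
  - by move=> x _; rewrite mule_ge0 ?lee_fin.
by apply: eq_integral => x _; rewrite EFinM muleA.
Qed.

End density_measure.

(** Normalising a measure of mass one turns it into a term of type
    [probability]. *)
Lemma probability_of_mass1 d (X : measurableType d) (R : realType)
    (m : {measure set X -> \bar R}) : m setT = 1%E ->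
  exists P : probability X R, forall E, P E = m E.
Proof.
move=> m1; exists (mnormalize m point) => E.
by rewrite /= /mnormalize m1 onee_eq0 /= invr1 mule1.
Qed.

(** * Changes of variables on the line *)

Section fundamental_theorem.
Context {R : realType}.
Notation mu := (@lebesgue_measure R).

Lemma FTC2_is_derive (f F : R -> R) (a b : R) : a < b ->
  (forall x, a <= x <= b -> {for x, continuous f}) ->
  (forall x, a <= x <= b -> is_derive x 1 F (f x)) ->
  (\int[mu]_(x in `[a, b]) (f x)%:E = (F b - F a)%:E)%E.
Proof.
move=> ab cf dF; rewrite EFinB.
have cF x : a <= x <= b -> {for x, continuous F}.
  move=> /dF dFx; apply/differentiable_continuous/derivable1_diffP.
  exact: ex_derive.
apply: continuous_FTC2 => //.
- by apply: continuous_in_subspaceT => x /set_mem/=; rewrite in_itv /= => /cf.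
- split.
  + move=> x; rewrite in_itv /= => /andP[/ltW ax /ltW xb].
    by have /dF dFx : a <= x <= b by [rewrite ax xb]; exact: ex_derive.
  + by apply/cvg_at_right_filter/cF; rewrite lexx ltW.
  + by apply/cvg_at_left_filter/cF; rewrite lexx ltW.
- move=> x; rewrite in_itv /= => /andP[/ltW ax /ltW xb].
  have /dF dFx : a <= x <= b by rewrite ax xb.
  by rewrite derive1E derive_val.
Qed.

Lemma is_derive_inv2 (x : R) : x != 0 ->
  is_derive x 1 (fun t : R => - (2 / t)) (2 / x ^+ 2).
Proof.
move=> x0; have dI : is_derive x 1 (fun t : R => t^-1) (- x ^- 2 *: 1).
  exact: (@is_deriveV _ id).
apply: is_derive_eq; rewrite /GRing.scale /= .
by rewrite !mulr1 !mulrN opprK.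
Qed.

Lemma continuous_inv2 (x : R) : x != 0 ->
  {for x, continuous (fun t : R => 2 / t ^+ 2)}.
Proof.
move=> x0; apply: cvgM; first exact: cvg_cst.
apply: cvgV; first by rewrite expf_neq0.
exact: exprn_continuous.
Qed.

Lemma integral_inv2_itv (p q : R) : 0 < p -> p <= q ->
  (\int[mu]_(t in `[p, q[) (2 / t ^+ 2)%:E = (2 / p - 2 / q)%:E)%E.
Proof.
move=> p0; rewrite le_eqVlt => /predU1P[<-|pq].
  by rewrite set_itvco0 integral_set0 subrr.
have pos x : p <= x <= q -> x != 0.
  by move=> /andP[px _]; rewrite gt_eqF// (lt_le_trans p0).
rewrite integral_itv_bndo_bndc; last first.
  apply/measurable_EFinP; apply: measurable_funTS.
  apply: measurable_funM => //; apply: measurableT_comp => //.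
    exact: measurable_inv.
transitivity ((- (2 / q) - - (2 / p))%:E); last by congr EFin; ring.
apply: (FTC2_is_derive (F := fun t => - (2 / t))) => // x /pos.
  exact: continuous_inv2.
exact: is_derive_inv2.
Qed.

Lemma integral_inv2_ray (p : R) : 0 < p ->
  (\int[mu]_(t in `[p, +oo[) (2 / t ^+ 2)%:E = (2 / p)%:E)%E.
Proof.
move=> p0.
have pos x : p <= x -> x != 0.
  by move=> px; rewrite gt_eqF// (lt_le_trans p0).
rewrite (@ge0_continuous_FTC2y _ _ (fun t => - (2 / t)) p 0).
- by congr EFin; ring.
- by move=> x _; rewrite divr_ge0// sqr_ge0.
- apply: continuous_in_subspaceT => x /set_mem/=; rewrite in_itv /= andbT => /pos.
  exact: continuous_inv2.
- rewrite -oppr0; apply: cvgN; rewrite -(mulr0 2); apply: cvgMr.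
  apply: (gtr0_cvgV0 (f := id) _).2 => //.
  exact: nbhs_pinfty_gt.
- by move=> x /ltW /pos /is_derive_inv2 dx; exact: ex_derive.
- have /pos /is_derive_inv2 dx := lexx p.
  have cp : {for p, continuous (fun t : R => - (2 / t))}.
    by apply/differentiable_continuous/derivable1_diffP; exact: ex_derive.
  exact: cvg_at_right_filter cp.
- move=> x; rewrite in_itv /= andbT => /ltW /pos /is_derive_inv2 dx.
  by rewrite derive1E derive_val.
Qed.

End fundamental_theorem.

Section change_of_variables.
Context {R : realType}.
Notation mu := (@lebesgue_measure R).
Local Open Scope ereal_scope.

Lemma ge0_integral_shift (f : R -> \bar R) (c : R) :
  measurable_fun setT f -> (forall x, 0 <= f x) ->
  \int[mu]_x f x = \int[mu]_x f (x + c)%R.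
Proof.
move=> mf f0.
have mc : measurable_fun [set: measurableTypeR R]
    (fun x : measurableTypeR R => (x + c)%R : measurableTypeR R).
  exact: measurable_funD.
pose phi : {mfun (measurableTypeR R) >-> (measurableTypeR R)} :=
  HB.pack (fun x : measurableTypeR R => (x + c)%R : measurableTypeR R)
    (isMeasurableFun.Build _ _ _ _ _ mc).
transitivity (\int[pushforward mu phi]_x f x).
  apply: eq_measure_integral => A mA _.
  apply: (@lebesgue_measure_unique _ (pushforward mu phi)) => //.
  move=> _ [[a b]] _ <-; rewrite /pushforward.
  transitivity (mu `](a - c)%R, (b - c)%R]); last first.
    congr (mu _).
    by apply/seteqP; split => x /=; rewrite !in_itv /= ltrBlDr lerBrDr.
  rewrite !lebesgue_measure_itv /= !lte_fin ltrD2r.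
  by case: ifP => // _; rewrite -!EFinB; congr EFin; ring.
by rewrite ge0_integral_pushforward// preimage_setT.
Qed.

Let m_inv2 : measurable_fun [set: measurableTypeR R] (fun t : R => 2 / t ^+ 2)%R.
Proof.
apply: measurable_funM => //; apply: measurableT_comp => //.
exact: measurable_inv.
Qed.

Let inv2_ge0 (t : R) : (0 <= 2 / t ^+ 2)%R.
Proof. by rewrite divr_ge0// sqr_ge0. Qed.

Let m_ray : measurable (`]0%R, +oo[%classic : set (measurableTypeR R)).
Proof. by []. Qed.

Let m_2inv : measurable_fun [set: measurableTypeR R]
  (fun t : measurableTypeR R => (2 / t)%R : measurableTypeR R).
Proof. by apply: measurable_funM => //; exact: measurable_inv. Qed.

Let m_neg : measurable (`]-oo, 0%R]%classic : set (measurableTypeR R)).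
Proof. by []. Qed.

Local Notation dinv2 := (dmeasure mu m_ray m_inv2 inv2_ge0).

(** Both sides are measures, so it is enough to compare them on half-open
    intervals, where the integral of [2 / t ^+ 2] is explicit. *)
Let lebesgue_measure_inv2 (A : set R) : measurable A ->
  mu A = mu (A `&` `]-oo, 0%R]) + dinv2 ((fun t : R => 2 / t)%R @^-1` A).
Proof.
move=> mA.
pose phi : {mfun (measurableTypeR R) >-> (measurableTypeR R)} :=
  HB.pack (fun t : measurableTypeR R => (2 / t)%R : measurableTypeR R)
    (isMeasurableFun.Build _ _ _ _ _ m_2inv).
rewrite -[RHS](measure_addE (mrestr mu m_neg) (pushforward dinv2 phi)).
apply: lebesgue_measure_unique mA => _ [[a b]] _ <-.
transitivity (mrestr mu m_neg `]a, b]%classic + pushforward dinv2 phi `]a, b]%classic);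
  last by rewrite -measure_addE.
rewrite /mrestr /pushforward /dmeasure /=.
have [ba|ab] := leP b a.
  by rewrite set_itv_ge ?bnd_simp -?leNgt// set0I preimage_set0 setI0
    integral_set0 !measure0 adde0.
rewrite lebesgue_measure_itv /= lte_fin ab.
have preim_pos (P : set R) : (forall t, 0 < t -> (a < 2 / t <= b) = (t \in P))%R ->
    P `<=` `]0%R, +oo[ -> `]0%R, +oo[ `&` (fun t : R => 2 / t)%R @^-1` `]a, b] = P.
  move=> PE P0; apply/seteqP; split=> t /=.
    by rewrite !in_itv /= andbT => -[t0]; rewrite PE// inE.
  by move=> Pt; have := P0 _ Pt; rewrite /= !in_itv /= andbT => t0; split => //; rewrite PE// inE.
have [b0|b0] := leP b 0%R.
  rewrite (_ : `]0%R, +oo[ `&` _ = set0); last first.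
    apply: preim_pos => // t t0; rewrite in_set0; apply/negbTE/negP => /andP[_].
    by rewrite leNgt (le_lt_trans b0)// divr_gt0.
  rewrite integral_set0 adde0 (_ : _ `&` _ = `]a, b]%classic).
    by rewrite lebesgue_measure_itv /= lte_fin ab.
  apply/setIidPl => x /=; rewrite !in_itv /= => /andP[_ xb].
  exact: le_trans b0.
have b20 : (0 < 2 / b)%R by rewrite divr_gt0.
have [a0|a0] := leP a 0%R.
  rewrite (_ : `]0%R, +oo[ `&` _ = `[(2 / b)%R, +oo[%classic); last first.
    apply: preim_pos.
      move=> t t0; rewrite mem_setE in_itv /= andbT (le_lt_trans a0) ?divr_gt0//=.
      by rewrite ler_pdivrMr// ler_pdivrMr// mulrC.
    by move=> t /=; rewrite !in_itv /= !andbT; exact: lt_le_trans.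
  rewrite integral_inv2_ray// (_ : _ `&` _ = `]a, 0%R]%classic).
    rewrite lebesgue_measure_itv /= lte_fin.
    move: a0; rewrite le_eqVlt => /predU1P[->|a0].
      by rewrite ltxx add0e oppr0 adde0; congr EFin; field; rewrite gt_eqF.
    rewrite a0 -!EFinB -EFinD; congr EFin; field; by rewrite gt_eqF.
  apply/seteqP; split => x /=; rewrite !in_itv /=.
    by move=> [/andP[-> _]].
  by move=> /andP[-> x0]; rewrite x0 (le_trans x0)// ltW.
rewrite (_ : `]0%R, +oo[ `&` _ = `[(2 / b)%R, (2 / a)%R[%classic); last first.
  apply: preim_pos.
    move=> t t0; rewrite mem_setE in_itv /= andbC.
    by rewrite ler_pdivrMr// ler_pdivrMr// [(t * b)%R]mulrC !ltr_pdivlMr// [(t * a)%R]mulrC.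
  by move=> t /=; rewrite !in_itv /= !andbT => /andP[+ _]; exact: lt_le_trans.
rewrite integral_inv2_itv//; last by rewrite ler_pM2l// lef_pV2 ?posrE// ltW.
rewrite (_ : _ `&` _ = set0).
  rewrite measure0 add0e -EFinB; congr EFin; field.
  by rewrite !gt_eqF.
apply/seteqP; split => x //=; rewrite !in_itv /=.
by move=> [/andP[ax _] x0]; have := lt_le_trans (lt_trans a0 ax) x0; rewrite ltxx.
Qed.

Lemma ge0_integral_inversion (f : R -> \bar R) :
  measurable_fun setT f -> (forall x, 0 <= f x) ->
  \int[mu]_(x in `]0%R, +oo[) f x =
  \int[mu]_(t in `]0%R, +oo[) (f (2 / t)%R * (2 / t ^+ 2)%:E).
Proof.
move=> mf f0.
pose phi : {mfun (measurableTypeR R) >-> (measurableTypeR R)} :=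
  HB.pack (fun t : measurableTypeR R => (2 / t)%R : measurableTypeR R)
    (isMeasurableFun.Build _ _ _ _ _ m_2inv).
transitivity (\int[pushforward dinv2 phi]_(x in `]0%R, +oo[) f x).
  apply: eq_measure_integral => A mA A0.
  apply: etrans (lebesgue_measure_inv2 mA) _.
  rewrite (_ : A `&` _ = set0) ?measure0 ?add0e//.
  apply/seteqP; split => x //= -[/A0]; rewrite /= !in_itv /= andbT => x0.
  by rewrite leNgt x0.
have mr : measurable_fun [set: measurableTypeR R] (f \_ `]0%R, +oo[).
  by apply/(measurable_restrictT _ _).1 => //; exact: measurable_funTS.
rewrite integral_mkcond ge0_integral_pushforward//; last first.
  by move=> y _; rewrite erestrict_ge0.
rewrite preimage_setT ge0_integral_dmeasure//=; last 2 first.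
- exact: (measurableT_comp mr m_2inv).
- by move=> x; rewrite erestrict_ge0.
apply: eq_integral => t; rewrite inE /= in_itv /= andbT => t0.
by rewrite patchE mem_set//= in_itv /= andbT divr_gt0.
Qed.

End change_of_variables.

Section gauss_branches.
Context {R : realType}.
Notation mu := (@lebesgue_measure R).
Local Open Scope ereal_scope.

Lemma measurable_inversion (c d : R) :
  measurable_fun [set: measurableTypeR R]
    (fun x : measurableTypeR R => (2 / (c + x) - d)%R : measurableTypeR R).
Proof.
apply: measurable_funB => //; apply: measurable_funM => //.
apply: (measurableT_comp (@measurable_inv R)).
exact: measurable_funD.
Qed.

Lemma ge0_integral_branch (f : R -> \bar R) (d : R) :
  measurable_fun setT f -> (forall x, 0 <= f x) ->
  \int[mu]_(x in `]0%R, +oo[) f x =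
  \int[mu]_(y in `](- d)%R, +oo[) (f (2 / (d + y))%R * (2 / (d + y) ^+ 2)%:E).
Proof.
move=> mf f0; rewrite ge0_integral_inversion//.
rewrite integral_mkcond (@ge0_integral_shift _ _ d); last 2 first.
- apply/(measurable_restrictT _ _).1 => //; apply: measurable_funTS.
  apply: emeasurable_funM.
    apply: measurableT_comp => //; apply: measurable_funM => //.
    exact: measurable_inv.
  apply/measurable_EFinP; apply: measurable_funM => //.
  by apply: measurableT_comp => //; exact: measurable_inv.
- move=> x; rewrite erestrict_ge0// => y _.
  by rewrite mule_ge0// lee_fin divr_ge0// sqr_ge0.
rewrite [RHS]integral_mkcond; apply: eq_integral => x _.
by rewrite !patchE !mem_setE !in_itv /= !andbT -ltrBlDr sub0r [(d + x)%R]addrC.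
Qed.

Lemma ge0_integral_fibre (f : R -> \bar R) (d : R) :
  measurable_fun setT f -> (forall x, 0 <= f x) ->
  \int[mu]_(y in `](- d)%R, +oo[) f y =
  \int[mu]_(t in `]0%R, +oo[) (f (2 / t - d)%R * (2 / t ^+ 2)%:E).
Proof.
move=> mf f0; rewrite integral_mkcond (@ge0_integral_shift _ _ (- d)%R); last 2 first.
- by apply/(measurable_restrictT _ _).1 => //; exact: measurable_funTS.
- by move=> x; rewrite erestrict_ge0.
rewrite -(@ge0_integral_inversion _ (fun t => f (t - d)%R))//; last first.
  by apply: measurableT_comp => //; exact: measurable_funB.
rewrite [RHS]integral_mkcond; apply: eq_integral => x _.
by rewrite !patchE !mem_setE !in_itv /= !andbT ltrBrDr addNr.
Qed.

(** The densities [1 / (1 + v x) ^+ 2] are permuted, up to a factor, by the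
    transfer operators of the branches [x = 2 / (d + y)]. *)
Definition gweight (v : R) (E : set R) : \bar R :=
  \int[mu]_(x in E) (((1 + v * x) ^+ 2)^-1)%:E.

Lemma measurable_gweight_density (v : R) :
  measurable_fun [set: R] (fun x : R => ((1 + v * x) ^+ 2)^-1)%R.
Proof.
apply: (measurableT_comp (@measurable_inv R)); apply: measurable_funX.
by apply: measurable_funD => //; exact: measurable_funM.
Qed.

Lemma gweight_branch (v d : R) (E : set R) :
  (0 <= v)%R -> (0 < d)%R -> measurable E -> E `<=` `]0%R, +oo[ ->
  gweight v E = (2 / (d + 2 * v) ^+ 2)%:E *
    gweight (d + 2 * v)^-1 [set y | - d < y /\ E (2 / (d + y))]%R.
Proof.
move=> v0 d0 mE E0; set F := [set y | _].
have dv0 : (0 < d + 2 * v)%R by rewrite ltr_pwDl// mulr_ge0.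
have mF : measurable F.
  have -> : F = `](- d)%R, +oo[ `&` (fun y : measurableTypeR R =>
      (2 / (d + y) - 0)%R : measurableTypeR R) @^-1` E.
    by apply/seteqP; split => y /=; rewrite in_itv /= andbT subr0.
  apply: measurableI => //; rewrite -[_ @^-1` _]setTI.
  exact: measurable_inversion.
pose f x := (((1 + v * x) ^+ 2)^-1)%:E * (\1_E x)%:E.
have f0 x : 0 <= f x.
  by rewrite mule_ge0 ?lee_fin// invr_ge0 sqr_ge0.
have mf : measurable_fun setT f.
  apply: emeasurable_funM; apply/measurable_EFinP.
    exact: measurable_gweight_density.
  exact: measurable_indic.
transitivity (\int[mu]_(x in `]0%R, +oo[) f x).
  rewrite /gweight integral_mkcond [RHS]integral_mkcond; apply: eq_integral => x _.
  rewrite !patchE /f indicE; case: ifPn => xE.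
    by rewrite mem_set ?mule1//; apply: E0; rewrite -inE.
  by case: ifPn => _; rewrite ?mule0.
rewrite (ge0_integral_branch d)// /gweight -ge0_integralZl//; last 3 first.
- apply/measurable_EFinP; apply: measurable_funTS.
  exact: measurable_gweight_density.
- by move=> x _; rewrite lee_fin invr_ge0 sqr_ge0.
- by rewrite lee_fin divr_ge0// sqr_ge0.
rewrite [LHS]integral_mkcond [RHS]integral_mkcond; apply: eq_integral => y _.
rewrite !patchE mem_setE in_itv /= andbT; case: ifPn => yd; last first.
  by rewrite memNset// => -[yd' _]; rewrite yd' in yd.
rewrite /f indicE; have [/= xE|xE] := boolP (_ \in E); last first.
  by rewrite mule0 mul0e memNset// => -[_ yE]; rewrite mem_set in xE.
rewrite mem_set; last by split=> //; rewrite inE in xE.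
rewrite mule1 -!EFinM; congr EFin.
have dy0 : (0 < d + y)%R by rewrite -ltrBlDl sub0r.
field.
by apply/and3P; split; apply: lt0r_neq0 => //; lra.
Qed.

(** * The kernel of the natural extension *)

Definition kernel (z : R * R) : R := 2 / (2 + z.1 * z.2) ^+ 2.

Definition branch_inv (d : R) (z : R * R) : R * R :=
  (2 / (d + z.1), 2 / z.2 - d)%R.

Notation MR2 := (measurableTypeR R * measurableTypeR R)%type.

Lemma measurable_kernel : measurable_fun [set: MR2] kernel.
Proof.
apply: measurable_funM => //; apply: (measurableT_comp (@measurable_inv R)).
apply: measurable_funX; apply: measurable_funD => //; apply: measurable_funM.
  exact: measurable_fst.
exact: measurable_snd.
Qed.

Lemma kernel_ge0 (z : R * R) : (0 <= kernel z)%R.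
Proof. by rewrite divr_ge0// sqr_ge0. Qed.

Lemma measurable_branch_inv (d : R) : measurable_fun [set: MR2] (branch_inv d : MR2 -> MR2).
Proof.
apply: measurable_fun_pair.
  have := measurable_inversion d 0; under eq_fun do rewrite subr0.
  move=> h; apply: (measurableT_comp h); exact: measurable_fst.
have := measurable_inversion 0 d; under eq_fun do rewrite add0r.
move=> h; apply: (measurableT_comp h); exact: measurable_snd.
Qed.

(** [branch_inv d] preserves the measure of density [kernel]: substitute in
    each coordinate separately; the two Jacobians are exactly the factor by
    which the kernel changes, because
    [2 + (2 / (d + x)) (2 / y - d) = 2 (2 + x y) / ((d + x) y)]. *)
Lemma integral_kernel_branch (d : R) (E : set MR2) :
  measurable E -> (forall z, E z -> 0 < z.1 /\ - d < z.2)%R ->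
  \int[leb2 R]_(z in E) (kernel z)%:E =
  \int[leb2 R]_(z in [set z | [/\ - d < z.1, 0 < z.2 & E (branch_inv d z)]]%R)
    (kernel z)%:E.
Proof.
move=> mE E0; set F := [set z | _].
have mF : measurable F.
  have -> : F = (`](- d)%R, +oo[ `*` `]0%R, +oo[) `&` (branch_inv d : MR2 -> MR2) @^-1` E.
    apply/seteqP; split => z /=; rewrite !in_itv /= !andbT.
      by case=> ? ? ?; split.
    by case=> -[? ?] ?; split.
  apply: measurableI; first exact: measurableX.
  rewrite -[_ @^-1` _]setTI; exact: measurable_branch_inv.
pose f A z := (kernel z)%:E * (\1_A z)%:E.
have f0 A z : 0 <= f A z by rewrite mule_ge0 ?lee_fin// kernel_ge0.
have mf A : measurable A -> measurable_fun [set: MR2] (f A).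
  move=> mA; apply: emeasurable_funM; apply/measurable_EFinP.
    exact: measurable_kernel.
  exact: measurable_indic.
have intf A : measurable A -> \int[leb2 R]_(z in A) (kernel z)%:E = \int[leb2 R]_z f A z.
  move=> mA; rewrite integral_mkcond; apply: eq_integral => z _.
  by rewrite patchE /f indicE; case: ifPn => _; rewrite ?mule1 ?mule0.
rewrite !intf// /leb2 !fubini_tonelli1//; [|exact: mf|exact: mf].
have mf1 A : measurable A -> forall x, measurable_fun [set: R] (fun y => f A (x, y)).
  by move=> mA x; apply: measurableT_comp; [exact: mf|exact: pair1_measurable].
pose G x := \int[mu]_(t in `]0%R, +oo[) (f E (x, 2 / t - d)%R * (2 / t ^+ 2)%:E).
have GE x : fubini_F mu (f E) x = G x.
  rewrite /fubini_F /G -(@ge0_integral_fibre (fun y => f E (x, y)) d)//; last exact: mf1.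
  rewrite [RHS]integral_mkcond; apply: eq_integral => y _.
  rewrite patchE mem_setE in_itv /= andbT; case: ifPn => // yd.
  rewrite /f indicE memNset ?mule0// => /E0[_ /=]; by rewrite (negbTE yd).
have mG : measurable_fun [set: R] G.
  rewrite -(_ : fubini_F mu (f E) = G); last exact/funext.
  by apply: measurable_fun_fubini_tonelli_F => //; exact: mf.
have G0 x : 0 <= G x by rewrite -GE; exact: integral_ge0.
transitivity (\int[mu]_(x in `]0%R, +oo[) G x).
  rewrite [RHS]integral_mkcond; apply: eq_integral => x _.
  apply: etrans (GE x) _.
  rewrite patchE mem_setE in_itv /= andbT; case: ifPn => // x0.
  rewrite -GE; apply: integral0_eq => y _.
  rewrite /f indicE memNset ?mule0// => /E0[/=]; by rewrite (negbTE x0).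
rewrite (ge0_integral_branch d)// integral_mkcond; apply: eq_integral => x _.
rewrite patchE mem_setE in_itv /= andbT; case: ifPn => xd; last first.
  symmetry; apply: integral0_eq => y _.
  by rewrite /f indicE memNset ?mule0// => -[/=]; rewrite (negbTE xd).
rewrite muleC -ge0_integralZl//; last 3 first.
- apply: measurable_funTS; apply: emeasurable_funM.
    have := measurable_inversion 0 d; under eq_fun do rewrite add0r.
    move=> h; apply: (measurableT_comp (mf1 _ mE (2 / (d + x))%R) h).
  apply/measurable_EFinP; apply: measurable_funM => //.
  by apply: measurableT_comp => //; exact: measurable_inv.
- by move=> t _; rewrite mule_ge0// lee_fin divr_ge0// sqr_ge0.
- by rewrite lee_fin divr_ge0// sqr_ge0.
rewrite integral_mkcond; apply: eq_integral => t _.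
rewrite patchE mem_setE in_itv /= andbT; case: ifPn => t0; last first.
  by rewrite /f indicE memNset ?mule0// => -[_ /=]; rewrite (negbTE t0).
rewrite /f !indicE.
have -> : ((2 / (d + x), 2 / t - d)%R \in E) = ((x, t) \in F).
  by apply/idP/idP; rewrite !inE => //= -[].
case: (_ \in F); rewrite ?mule0 ?mul0e ?mule0// !mule1 -!EFinM; congr EFin.
rewrite /kernel /=.
have dx0 : (d + x != 0)%R by rewrite gt_eqF// -ltrBlDl sub0r.
have tn0 : t != 0%R by rewrite gt_eqF.
have -> : (2 + 2 / (d + x) * (2 / t - d) = 2 * (2 + x * t) / ((d + x) * t))%R.
  by field; rewrite dx0 tn0.
have [->|h] := eqVneq (2 + x * t)%R 0%R.
  by rewrite mulr0 mul0r !expr0n/= !invr0 !mulr0 mul0r mulr0.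
by field; rewrite dx0 tn0 h.
Qed.

End gauss_branches.

(** * Ergodicity *)

Section ergodicity.
Context {R : realType}.
Notation mu := (@lebesgue_measure R).
Variable alpha : R.
Hypotheses (alpha0 : 0 < alpha) (alphaA : 2 < alpha ^+ 2 + 5 * alpha).
Hypothesis alphaB : alpha ^+ 2 + 2 * alpha < 1.

Local Notation T := (T alpha).

Lemma T_branch (d : nat) (x : R) :
  alpha <= 2 / x - d%:R < alpha + 1 -> T x = 2 / x - d%:R.
Proof.
move=> /andP[h1 h2]; rewrite /Defs.T /d1 (@floor_def _ _ d%:Z)//.
by rewrite rmorphD /=; apply/andP; split; lra.
Qed.

Lemma alpha_gt : 37 / 100 < alpha.
Proof.
by move: alpha0 alphaA => a0 aA; rewrite ltNge; apply/negP => h; nra.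
Qed.

Lemma alpha_lt : alpha < 415 / 1000.
Proof. by move: alphaB => aB; rewrite ltNge; apply/negP => h; nra. Qed.

(** The branch of digit [d] is the interval with end points [cut d.+1] and
    [cut d]. *)
Definition cut (d : nat) : R := 2 / (alpha + d%:R).

Lemma le_cut d (x : R) : 0 < x -> (x <= cut d) = (alpha <= 2 / x - d%:R).
Proof.
move=> x0; have ad0 : 0 < alpha + d%:R by rewrite ltr_wpDr.
by rewrite /cut ler_pdivlMr// lerBrDr ler_pdivlMr// mulrC.
Qed.

Lemma cut_le d (x : R) : 0 < x -> (cut d <= x) = (2 / x - d%:R <= alpha).
Proof.
move=> x0; have ad0 : 0 < alpha + d%:R by rewrite ltr_wpDr.
by rewrite /cut ler_pdivrMr// lerBlDr ler_pdivrMr// mulrC.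
Qed.

Lemma cutS_le d (x : R) : 0 < x -> (cut d.+1 <= x) = (2 / x - d%:R <= alpha + 1).
Proof.
move=> x0; rewrite cut_le// -natr1.
by apply/idP/idP => h; lra.
Qed.

Lemma inv_cut d : 2 / cut d - d%:R = alpha.
Proof.
by rewrite /cut; field; rewrite /= gt_eqF// ltr_wpDr.
Qed.

Lemma inv_cutS d : 2 / cut d.+1 - d%:R = alpha + 1.
Proof. by rewrite -[in RHS](inv_cut d.+1) -natr1; ring. Qed.

Lemma cut_homo (d e : nat) : (d < e)%N -> cut e < cut d.
Proof.
move=> de; have pos k : 0 < alpha + k%:R :> R by rewrite ltr_wpDr.
by rewrite /cut ltr_pM2l// ltf_pV2 ?posrE// ltrD2l ltr_nat.
Qed.

Lemma cut5_le : cut 5 <= alpha.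
Proof.
by move: alphaA => aA; rewrite cut_le// lerBlDr ler_pdivrMr//; nra.
Qed.

Lemma alpha_lt_cut4 : alpha < cut 4.
Proof.
move: alphaB alpha0 (sqr_ge0 alpha) => aB a0 a2.
by rewrite /cut ltr_pdivlMr; nra.
Qed.

Lemma cut2_lt : cut 2 < alpha + 1.
Proof.
move: alpha_gt (sqr_ge0 alpha) => aA a2.
by rewrite /cut ltr_pdivrMr; nra.
Qed.

Lemma le_cut1 : alpha + 1 <= cut 1.
Proof.
move: alphaB alpha0 alpha_lt => aB a0 aL.
by rewrite /cut ler_pdivlMr; nra.
Qed.

Section weights.
Local Open Scope ereal_scope.

Lemma gweight_ge0 (v : R) E : 0 <= gweight v E.
Proof. by apply: integral_ge0 => x _; rewrite lee_fin invr_ge0 sqr_ge0. Qed.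

Lemma measurable_gweight (v : R) E :
  measurable_fun E (fun x : R => (((1 + v * x) ^+ 2)^-1)%:E).
Proof.
apply/measurable_EFinP; apply: measurable_funTS.
exact: measurable_gweight_density.
Qed.

Lemma le_gweight (v : R) (E F : set R) : measurable E -> measurable F ->
  E `<=` F -> gweight v E <= gweight v F.
Proof.
move=> mE mF EF; apply: ge0_subset_integral => //.
- exact: measurable_gweight.
- by move=> x _; rewrite lee_fin invr_ge0 sqr_ge0.
Qed.

Lemma gweight_split (v p r q : R) (X : set R) : measurable X ->
  (p < r < q)%R ->
  gweight v (`]p, q[ `&` X) = gweight v (`]p, r[ `&` X) + gweight v (`]r, q[ `&` X).
Proof.
move=> mX /andP[pr rq].
have -> : `]p, q[ `&` X = (`]p, r[ `&` X) `|` (`[r, q[ `&` X).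
  rewrite -setIUl; congr (_ `&` _); apply/seteqP; split => x /=; rewrite !in_itv /=.
    by move=> /andP[px xq]; case: (ltP x r) => xr; [left|right]; rewrite ?px.
  move=> [/andP[-> xr]|/andP[rx ->]]; first by rewrite (lt_trans xr).
  by rewrite (lt_le_trans pr).
rewrite /gweight ge0_integral_setU//; last 5 first.
- exact: measurableI.
- exact: measurableI.
- exact: measurable_gweight.
- by move=> x _; rewrite lee_fin invr_ge0 sqr_ge0.
- apply/disj_setPS => x [[/= + _] [/= + _]]; rewrite !in_itv /=.
  by move=> /andP[_ xr] /andP[rx _]; have := lt_le_trans xr rx; rewrite ltxx.
congr (_ + _).
have rE : (`[r, q[ `&` X) `\ r = `]r, q[ `&` X.
  apply/seteqP; split => x /=; rewrite !in_itv /=.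
    move=> [[/andP[rx xq] Xx] /eqP xr]; split => //.
    by rewrite xq lt_neqAle eq_sym xr rx.
  move=> [/andP[rx xq] Xx]; split; first by rewrite xq (ltW rx).
  by apply/eqP; rewrite gt_eqF.
rewrite -[LHS](integral_setD1 (r := r)) rE//.
- exact: measurableI.
- exact: measurable_gweight.
Qed.

Lemma gweight_lb (v : R) (E : set R) : (0 <= v)%R -> measurable E ->
  E `<=` `]0%R, 2%R[ -> ((4 * (1 + v) ^+ 2)^-1)%:E * mu E <= gweight v E.
Proof.
move=> v0 mE E2; rewrite -integral_cst//; apply: ge0_le_integral => //=.
- by move=> x _; rewrite lee_fin invr_ge0 mulr_ge0// sqr_ge0.
- exact: measurable_gweight.
- move=> x /E2 /=; rewrite in_itv /= lee_fin => /andP[x0 x2].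
  have vx : (0 <= v * x)%R by rewrite mulr_ge0// ltW.
  have vx2 : (v * x <= v * 2)%R by rewrite ler_wpM2l// ltW.
  have -> : (4 * (1 + v) ^+ 2 = (2 * (1 + v)) ^+ 2)%R by ring.
  rewrite lef_pV2 ?posrE ?exprn_gt0//; [|lra|lra].
  by rewrite ler_sqr ?nnegrE; lra.
Qed.

Lemma gweight_ub (v p q : R) : (0 <= v)%R -> (alpha <= p)%R -> (q <= alpha + 1)%R ->
  gweight v `]p, q[ <= (9 / (1 + v) ^+ 2)%:E.
Proof.
move=> v0 ap qb; have a1 := alpha_gt.
apply: (@le_trans _ _ (\int[mu]_(x in `]p, q[) (9 / (1 + v) ^+ 2)%:E)).
  apply: ge0_le_integral => //=.
  - by move=> x _; rewrite lee_fin invr_ge0 sqr_ge0.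
  - exact: measurable_gweight.
  - move=> x; rewrite /= in_itv /= lee_fin => /andP[px xq].
    have vx : (v / 3 <= v * x)%R by rewrite ler_wpM2l//; lra.
    rewrite -[leLHS]mul1r ler_pdivrMr ?exprn_gt0//; last by lra.
    rewrite mulrAC ler_pdivlMr ?exprn_gt0//; last by lra.
    have -> : (9 * (1 + v * x) ^+ 2 = (3 * (1 + v * x)) ^+ 2)%R by ring.
    by rewrite mul1r ler_sqr ?nnegrE; lra.
rewrite integral_cst//= lebesgue_measure_itv /= lte_fin.
have h : (0 <= 9 / (1 + v) ^+ 2)%R by rewrite divr_ge0// sqr_ge0.
case: ifPn => pq; last by rewrite mule0 lee_fin.
by rewrite -EFinB -EFinM lee_fin ler_piMr//; lra.
Qed.

End weights.

Section invariant_set.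
Variable B : set R.
Hypotheses (mB : measurable B).
Hypothesis BT : forall x, alpha < x < alpha + 1 -> B x -> B (T x).
Local Open Scope ereal_scope.

Local Notation miss v p q := (gweight v (`]p, q[ `\` B)).

Let m_itvB p q : measurable (`]p, q[ `\` B).
Proof. exact: measurableD. Qed.

Section one_branch.
Variables (d : nat) (p q : R).
Hypotheses (d0 : (0 < d)%N) (ap : (alpha <= p)%R) (pq : (p < q)%R).
Hypotheses (qb : (q <= alpha + 1)%R) (cutp : (cut d.+1 <= p)%R).
Hypothesis cutq : (q <= cut d)%R.

Let p0 : (0 < p)%R. Proof. exact: lt_le_trans ap. Qed.
Let q0 : (0 < q)%R. Proof. exact: lt_trans pq. Qed.

Lemma branch_image : (alpha <= 2 / q - d%:R /\ 2 / q - d%:R < 2 / p - d%:R /\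
  2 / p - d%:R <= alpha + 1)%R.
Proof.
split; first by rewrite -le_cut.
split; last by rewrite -cutS_le.
by rewrite ltrD2r ltr_pM2l// ltf_pV2.
Qed.

Let branch_itv (y : R) : (- d%:R < y)%R ->
  (p < 2 / (d%:R + y) < q)%R = (2 / q - d%:R < y < 2 / p - d%:R)%R.
Proof.
move=> dy'; have dy : (0 < d%:R + y)%R by rewrite -ltrBlDl sub0r.
rewrite ltr_pdivlMr// ltr_pdivrMr// andbC ltrBlDl ltrBrDl.
by rewrite ltr_pdivrMr// ltr_pdivlMr// [(q * _)%R]mulrC [(p * _)%R]mulrC.
Qed.

Let sub_ray X : `]p, q[ `&` X `<=` `]0%R, +oo[.
Proof. by move=> x [/=]; rewrite !in_itv /= andbT => /andP[+ _] _; exact: lt_trans. Qed.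

Lemma gweight_pull (v : R) : (0 <= v)%R ->
  gweight v `]p, q[ = (2 / (d%:R + 2 * v) ^+ 2)%:E *
    gweight (d%:R + 2 * v)^-1 `](2 / q - d%:R)%R, (2 / p - d%:R)%R[.
Proof.
move=> v0; rewrite (@gweight_branch _ v d%:R)//; last 2 first.
- by rewrite ltr0n.
- by rewrite -[X in X `<=` _]setIT; exact: sub_ray.
congr (_ * gweight _ _); apply/seteqP; split => y /=; rewrite !in_itv /=.
  by move=> [dy]; rewrite branch_itv.
move=> yi; have dy : (- d%:R < y)%R.
  have [+ _] := branch_image; case/andP: yi => + _ => h1 h2.
  by move: alpha0 (ler0n R d); lra.
by split=> //; rewrite branch_itv.
Qed.

(** A point of [B] is mapped into [B], so the part of the image that [B] misses
    is covered by the image of the part that [B] misses. *)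
Lemma miss_pull (v : R) : (0 <= v)%R ->
  (2 / (d%:R + 2 * v) ^+ 2)%:E *
    miss (d%:R + 2 * v)^-1 (2 / q - d%:R)%R (2 / p - d%:R)%R <= miss v p q.
Proof.
move=> v0; rewrite (@gweight_branch _ v d%:R (`]p, q[ `\` B))//; last 2 first.
- by rewrite ltr0n.
- exact: sub_ray.
rewrite lee_pmul2l ?lte_fin//; last first.
  by rewrite divr_gt0// exprn_gt0// ltr_pwDl ?ltr0n// mulr_ge0.
apply: le_gweight => //.
  have -> : [set y | (- d%:R < y)%R /\ (`]p, q[ `\` B) (2 / (d%:R + y))%R] =
    `](- d%:R)%R, +oo[ `&` (fun y : measurableTypeR R =>
      (2 / (d%:R + y) - 0)%R : measurableTypeR R) @^-1` (`]p, q[ `\` B).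
    by apply/seteqP; split => y /=; rewrite !in_itv /= ?andbT subr0.
  apply: measurableI => //; rewrite -[_ @^-1` _]setTI.
  by apply: measurable_inversion => //; exact: m_itvB.
move=> y /= [yi yB]; rewrite !in_itv /= in yi *.
have [h1 [_ h2]] := branch_image; case/andP: (yi) => yl yr.
have dy : (- d%:R < y)%R by move: alpha0 (ler0n R d); lra.
split=> //; rewrite branch_itv//; split=> // xB; apply: yB.
have xpq : (p < 2 / (d%:R + y) < q)%R by rewrite branch_itv.
case/andP: xpq => px xq.
have yE : (2 / (2 / (d%:R + y)) - d%:R = y)%R.
  by field; rewrite gt_eqF// -ltrBlDl sub0r.
rewrite -[y]yE -(@T_branch d).
  apply: BT => //; apply/andP; split; first exact: le_lt_trans px.
  exact: lt_le_trans qb.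
by rewrite yE; apply/andP; split; [exact: ltW (le_lt_trans h1 yl)|exact: lt_le_trans h2].
Qed.

End one_branch.

Section no_full_branch_missed.
Variable C : R.
Hypothesis C0 : (0 <= C)%R.

(** [good e p q] compares an interval with the part that [B] misses, up to an
    error [e]. The weight [1 / (1 + v) ^+ 2] is the value of the density at the
    fixed point [1] of [x = 2 / (1 + x)]; this choice makes the error shrink by
    the factor two under every branch. *)
Definition good (e p q : R) := forall v : R, (0 <= v)%R ->
  gweight v `]p, q[ <= C%:E * miss v p q + (e / (1 + v) ^+ 2)%:E.

Lemma goodW (e e' p q : R) : (e <= e')%R -> good e p q -> good e' p q.
Proof.
move=> ee h v v0; apply: (le_trans (h v v0)); apply: leeD2l.
by rewrite lee_fin ler_pM2r// invr_gt0 exprn_gt0//; lra.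
Qed.

Lemma good_branch (e p q : R) (d : nat) : (0 <= e)%R -> (0 < d)%N ->
  (alpha <= p)%R -> (p < q)%R -> (q <= alpha + 1)%R ->
  (cut d.+1 <= p)%R -> (q <= cut d)%R ->
  good e (2 / q - d%:R) (2 / p - d%:R) -> good (e / 2) p q.
Proof.
move=> e0 d0 ap pq qb cp cq h v v0.
have dv : (0 < d%:R + 2 * v)%R by rewrite ltr_pwDl ?ltr0n// mulr_ge0.
have a0 : (0 <= 2 / (d%:R + 2 * v) ^+ 2)%R by rewrite divr_ge0// sqr_ge0.
rewrite (gweight_pull d0)//.
apply: (@le_trans _ _ ((2 / (d%:R + 2 * v) ^+ 2)%:E *
  (C%:E * miss (d%:R + 2 * v)^-1 (2 / q - d%:R)%R (2 / p - d%:R)%R +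
   (e / (1 + (d%:R + 2 * v)^-1) ^+ 2)%:E))).
  by apply: lee_wpmul2l; rewrite ?lee_fin//; apply: h; rewrite invr_ge0 ltW.
rewrite ge0_muleDr; last 2 first.
- by rewrite mule_ge0 ?lee_fin// gweight_ge0.
- by rewrite lee_fin divr_ge0// sqr_ge0.
apply: leeD.
  by rewrite muleCA; apply: lee_wpmul2l; rewrite ?lee_fin//; exact: miss_pull.
have d1 : (1 <= d%:R :> R)%R by rewrite ler1n.
rewrite -EFinM lee_fin.
have -> : (2 / (d%:R + 2 * v) ^+ 2 * (e / (1 + (d%:R + 2 * v)^-1) ^+ 2) =
   e * (2 / (d%:R + 2 * v + 1) ^+ 2))%R.
  by field; rewrite !gt_eqF//; lra.
rewrite -mulrA; apply: ler_wpM2l => //.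
have -> : (2^-1 / (1 + v) ^+ 2 = 2 / (2 * (1 + v)) ^+ 2)%R.
  by field; rewrite gt_eqF//; lra.
rewrite ler_pM2l// lef_pV2 ?posrE ?exprn_gt0//; [|lra|lra].
by rewrite ler_sqr ?nnegrE; lra.
Qed.

Lemma good_cat (e1 e2 p r q : R) : (p < r < q)%R ->
  good e1 p r -> good e2 r q -> good (e1 + e2) p q.
Proof.
move=> prq h1 h2 v v0.
rewrite -[`]p, q[%classic]setIT (gweight_split _ measurableT prq) !setIT.
rewrite setDE (gweight_split _ (measurableC mB) prq) -!setDE.
rewrite ge0_muleDr ?gweight_ge0// mulrDl EFinD [leRHS]addeACA.
by apply: leeD; [exact: h1|exact: h2].
Qed.

Hypothesis full : forall d : nat, (1 <= d <= 4)%N -> forall p q : R,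
  (alpha <= p)%R -> (q <= alpha + 1)%R ->
  (p <= Num.max alpha (cut d.+1))%R -> (Num.min (cut d) (alpha + 1) <= q)%R ->
  good 0 p q.

Variable e : R.
Hypothesis e0 : (0 <= e)%R.
Hypothesis good_e : forall p q : R, (alpha <= p)%R -> (p < q)%R -> (q <= alpha + 1)%R ->
  good e p q.

Let good_uncut (p q : R) (d : nat) : (0 < d)%N -> (alpha <= p)%R -> (p < q)%R ->
  (q <= alpha + 1)%R -> (cut d.+1 <= p)%R -> (q <= cut d)%R -> good (e / 2) p q.
Proof.
move=> d0 ap pq qb cp cq; apply: (good_branch e0 d0) => //.
have [h1 [h2 h3]] := branch_image ap pq cp cq.
exact: good_e.
Qed.

(** After a cut both pieces have an image that starts at an end point of the
    whole interval: it contains a branch or is not cut again. *)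
Let good_left (x : R) : (alpha < x)%R -> (x <= alpha + 1)%R -> good (e / 2) alpha x.
Proof.
move=> ax xb; have [xc|xc] := leP x (cut 4).
  by apply: (@good_uncut _ _ 4) => //; exact: cut5_le.
apply: (@goodW 0); first by rewrite divr_ge0.
by apply: (@full 4) => //; rewrite ?le_max ?lexx// ge_min (ltW xc).
Qed.

Let good_right (y : R) : (alpha <= y)%R -> (y < alpha + 1)%R ->
  good (e / 2) y (alpha + 1).
Proof.
move=> ay yb; have [cy|yc] := leP (cut 2) y.
  by apply: (@good_uncut _ _ 1) => //; exact: le_cut1.
apply: (@goodW 0); first by rewrite divr_ge0.
by apply: (@full 1) => //; rewrite ?le_max ?(ltW yc) ?orbT// ge_min lexx orbT.
Qed.

Let good_cut (d : nat) (p q : R) : (0 < d)%N -> (alpha <= p)%R -> (q <= alpha + 1)%R ->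
  (cut d.+2 <= p)%R -> (p < cut d.+1)%R -> (cut d.+1 < q)%R -> (q <= cut d)%R ->
  good (e / 2) p q.
Proof.
move=> d0 ap qb cp pc cq qc.
have e20 : (0 <= e / 2)%R by rewrite divr_ge0.
have -> : (e / 2 = e / 2 / 2 + e / 2 / 2)%R by lra.
apply: (@good_cat _ _ _ (cut d.+1)); first by rewrite pc cq.
  have cb : (cut d.+1 <= alpha + 1)%R by exact: ltW (lt_le_trans cq qb).
  apply: (@good_branch _ _ _ d.+1) => //.
  have [_ [h2 h3]] := branch_image ap pc cp (lexx _).
  by rewrite inv_cut in h2 *; exact: good_left.
have ac : (alpha <= cut d.+1)%R by exact: ltW (le_lt_trans ap pc).
apply: (@good_branch _ _ _ d) => //.
have [h1 [h2 _]] := branch_image ac cq (lexx _) qc.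
by rewrite inv_cutS in h2 *; exact: good_right.
Qed.

Lemma good_halve (p q : R) : (alpha <= p)%R -> (p < q)%R -> (q <= alpha + 1)%R ->
  good (e / 2) p q.
Proof.
move=> ap pq qb.
have fullW d p' q' : (1 <= d <= 4)%N -> (alpha <= p')%R -> (q' <= alpha + 1)%R ->
    (p' <= cut d.+1)%R -> (cut d <= q')%R -> good (e / 2) p' q'.
  move=> d14 ap' qb' pc cq; apply: (@goodW 0); first by rewrite divr_ge0.
  by apply: (full d14) => //; rewrite ?le_max ?pc ?orbT// ge_min cq.
have [p4|p4] := ltP p (cut 4).
  have [q4|q4] := leP q (cut 4).
    by apply: (@good_uncut _ _ 4) => //; exact: le_trans cut5_le ap.
  have [q3|q3] := leP (cut 3) q; first by apply: (fullW 3%N) => //; exact: ltW.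
  by apply: (@good_cut 3) => //; [exact: le_trans cut5_le ap|exact: ltW].
have [p3|p3] := ltP p (cut 3).
  have [q3|q3] := leP q (cut 3); first exact: (@good_uncut _ _ 3).
  have [q2|q2] := leP (cut 2) q; first by apply: (fullW 2%N) => //; exact: ltW.
  by apply: (@good_cut 2) => //; exact: ltW.
have [p2|p2] := ltP p (cut 2).
  have [q2|q2] := leP q (cut 2); first exact: (@good_uncut _ _ 2).
  by apply: (@good_cut 1) => //; exact: le_trans qb le_cut1.
by apply: (@good_uncut _ _ 1) => //; exact: le_trans qb le_cut1.
Qed.

End no_full_branch_missed.

End invariant_set.

End ergodicity.

Section invariant_sets_are_trivial.
Context {R : realType}.
Notation mu := (@lebesgue_measure R).
Variable alpha : R.
Hypotheses (alpha0 : 0 < alpha) (alphaA : 2 < alpha ^+ 2 + 5 * alpha).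
Hypothesis alphaB : alpha ^+ 2 + 2 * alpha < 1.
Variable B : set R.
Hypotheses (mB : measurable B).
Hypothesis BT : forall x, alpha < x < alpha + 1 -> B x -> B (T alpha x).
Local Open Scope ereal_scope.

Local Notation cut := (cut alpha).
Local Notation miss v p q := (gweight v (`]p, q[ `\` B)).

Let m_itvB p q : measurable (`]p, q[ `\` B).
Proof. exact: measurableD. Qed.

Let itv_sub2 p q X : (alpha <= p)%R -> (q <= alpha + 1)%R ->
  `]p, q[ `&` X `<=` `]0%R, 2%R[.
Proof.
move=> ap qb x [/= + _]; rewrite !in_itv /= => /andP[px xq].
rewrite (lt_trans alpha0) ?(le_lt_trans ap)//=.
by rewrite (lt_trans (lt_le_trans xq qb))//; move: (alpha_lt alphaB); lra.
Qed.

Let miss_lb v p q : (0 <= v)%R -> (alpha <= p)%R -> (q <= alpha + 1)%R ->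
  ((4 * (1 + v) ^+ 2)^-1)%:E * mu (`]p, q[ `\` B) <= miss v p q.
Proof. by move=> v0 ap qb; apply: gweight_lb => //; exact: itv_sub2. Qed.

Let le_mu_miss p q p' q' : (p' <= p)%R -> (q <= q')%R ->
  mu (`]p, q[ `\` B) <= mu (`]p', q'[ `\` B).
Proof.
move=> pp qq; apply: le_measure; rewrite ?inE; [exact: m_itvB..|].
apply: setSD => x /=.
by rewrite !in_itv /= => /andP[px xq]; rewrite (le_lt_trans pp)// (lt_le_trans xq).
Qed.

Let branch_pos (d : nat) (p q : R) : (0 < d)%N -> (alpha <= p)%R -> (p < q)%R ->
  (q <= alpha + 1)%R -> (cut d.+1 <= p)%R -> (q <= cut d)%R ->
  0 < mu (`](2 / q - d%:R)%R, (2 / p - d%:R)%R[ `\` B) ->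
  0 < mu (`]p, q[ `\` B).
Proof.
move=> d0 ap pq qb cp cq im0; rewrite lt0e measure_ge0 andbT; apply/eqP => m0.
have [h1 [h2 h3]] := branch_image alpha0 ap pq cp cq.
have := @miss_pull _ _ alpha0 _ mB BT _ _ _ d0 ap pq qb cp cq 0%R (lexx _).
rewrite leNgt => /negP; apply.
rewrite [X in X < _](_ : _ = 0); last first.
  rewrite /gweight; apply: null_set_integral;
    [exact: m_itvB|exact: measurable_gweight|exact: m0].
have d1 : (0 < d%:R + 2 * 0 :> R)%R by rewrite mulr0 addr0 ltr0n.
rewrite mule_gt0 ?lte_fin ?divr_gt0 ?exprn_gt0//.
have v0 : (0 <= (d%:R + 2 * 0)^-1 :> R)%R by rewrite invr_ge0 ltW.
by apply: lt_le_trans (miss_lb v0 h1 h3); rewrite mule_gt0// lte_fin.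
Qed.

Hypothesis not_full : mu (`]alpha, (alpha + 1)%R[ `\` B) != 0.

Let pos23 (d : nat) : (d = 2%N \/ d = 3%N) -> 0 < mu (`]cut d.+1, cut d[ `\` B).
Proof.
move=> d23.
have d0 : (0 < d)%N by case: d23 => ->.
have c2 : (cut d <= alpha + 1)%R.
  have := cut2_lt alpha0 alphaA => h; case: d23 => ->; first exact: ltW.
  by apply: ltW; apply: lt_trans h; exact: cut_homo.
have c4 : (alpha <= cut d.+1)%R.
  have := alpha_lt_cut4 alpha0 alphaB => h; case: d23 => ->; last exact: ltW.
  by apply: ltW; apply: (lt_trans h); exact: cut_homo.
have cc : (cut d.+1 < cut d)%R by exact: cut_homo.
apply: (@branch_pos d) => //.
by rewrite inv_cut// inv_cutS// lt0e not_full measure_ge0.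
Qed.

Let branch_missed (d : nat) : (1 <= d <= 4)%N ->
  0 < mu (`]Num.max alpha (cut d.+1), Num.min (cut d) (alpha + 1)%R[ `\` B).
Proof.
have c54 := cut5_le alpha0 alphaA; have c4 := alpha_lt_cut4 alpha0 alphaB.
have c43 : (cut 4 < cut 3)%R by exact: cut_homo.
have c32 : (cut 3 < cut 2)%R by exact: cut_homo.
have c2 := cut2_lt alpha0 alphaA; have c1 := le_cut1 alpha0 alphaB.
have a3 := alpha_gt alpha0 alphaA; have a4 := alpha_lt alphaB.
case: d => [//|[|[|[|[|//]]]]] _.
- rewrite max_r; last by apply/ltW; lra.
  rewrite min_r//; apply: (@branch_pos 1) => //; first by apply/ltW; lra.
  apply: lt_le_trans (pos23 (or_introl erefl)) _.
  rewrite inv_cutS//; apply: le_mu_miss; last exact: ltW.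
  rewrite /cut ler_pdivlMr; last by rewrite ltr_wpDr.
  rewrite mulrBl mul1r mulrAC lerBlDr ler_pdivrMr; last by lra.
  move: alpha0 => a0; nra.
- rewrite max_r; last by apply/ltW; lra.
  by rewrite min_l; [apply: pos23; left|exact: ltW].
- rewrite max_r; last by apply/ltW; lra.
  by rewrite min_l; [apply: pos23; right|apply/ltW; lra].
- rewrite max_l// min_l; last by apply/ltW; lra.
  apply: (@branch_pos 4) => //; first by apply/ltW; lra.
  apply: lt_le_trans (pos23 (or_intror erefl)) _.
  rewrite inv_cut//; apply: le_mu_miss; first exact: ltW.
  rewrite /cut ler_pdivrMr; last by rewrite ltr_wpDr.
  rewrite mulrBl mulrAC lerBrDr ler_pdivlMr//.
  move: alphaB alpha0 => aB a0; nra.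
Qed.

(** A set that is mapped into itself and misses part of the interval misses a
    fixed proportion of every interval. *)
Lemma uniformly_missed : exists2 C : R, (0 < C)%R & forall p q : R,
  (alpha <= p)%R -> (p < q)%R -> (q <= alpha + 1)%R ->
  (q - p)%:E <= C%:E * mu (`]p, q[ `\` B).
Proof.
pose m d := mu (`]Num.max alpha (cut d.+1), Num.min (cut d) (alpha + 1)%R[ `\` B).
have m_fin d : m d \is a fin_num.
  rewrite ge0_fin_numE//; apply: (@le_lt_trans _ _ (mu `]alpha, (alpha + 1)%R[)).
    apply: le_measure; rewrite ?inE//; first exact: m_itvB.
    move=> x [/= + _]; rewrite !in_itv /= gt_max lt_min => /andP[/andP[-> _]].
    by move=> /andP[_ ->].
  by rewrite lebesgue_measure_itv /=; case: ifP; rewrite ?ltry.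
have m_pos d : (1 <= d <= 4)%N -> (0 < fine (m d))%R.
  move=> d14; rewrite -lte_fin fineK//; exact: branch_missed.
pose C : R := (\sum_(1 <= d < 5) 36 / fine (m d))%R.
have CE d : (1 <= d <= 4)%N -> (36 / fine (m d) <= C)%R.
  move=> d14; rewrite /C (bigD1_seq d) ?iota_uniq ?mem_index_iota//=.
  rewrite lerDl big_seq_cond; apply: sumr_ge0 => i /andP[].
  rewrite mem_index_iota => /m_pos mi _; by rewrite divr_ge0// ltW.
have C0 : (0 < C)%R.
  apply: lt_le_trans (CE 1%N isT); rewrite divr_gt0//; exact: m_pos.
have C0' : (0 <= C)%R by exact: ltW.
exists C => //.
have full d : (1 <= d <= 4)%N -> forall p q : R,
    (alpha <= p)%R -> (q <= alpha + 1)%R ->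
    (p <= Num.max alpha (cut d.+1))%R -> (Num.min (cut d) (alpha + 1) <= q)%R ->
    good B C 0 p q.
  move=> d14 p q ap qb pm mq v v0; rewrite mul0r adde0.
  apply: (le_trans (gweight_ub alpha0 alphaA v0 ap qb)).
  apply: (@le_trans _ _ (C%:E * (((4 * (1 + v) ^+ 2)^-1)%:E * mu (`]p, q[ `\` B)))).
    apply: (@le_trans _ _ (C%:E * (((4 * (1 + v) ^+ 2)^-1)%:E * m d))).
      rewrite -(fineK (m_fin d)) -!EFinM lee_fin.
      apply: (@le_trans _ _ (36 / fine (m d) * ((4 * (1 + v) ^+ 2)^-1 * fine (m d))))%R.
        rewrite le_eqVlt; apply/orP; left; apply/eqP; field.
        by rewrite (gt_eqF (m_pos _ d14)) gt_eqF//; lra.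
      apply: ler_wpM2r; last exact: CE.
      by rewrite mulr_ge0 ?(ltW (m_pos _ d14))// invr_ge0 mulr_ge0// sqr_ge0.
    apply: lee_wpmul2l; rewrite ?lee_fin//.
    apply: lee_wpmul2l; rewrite ?lee_fin//; last exact: le_mu_miss.
    by rewrite invr_ge0 mulr_ge0// sqr_ge0.
  by apply: lee_wpmul2l; rewrite ?lee_fin//; exact: miss_lb.
have good_n n : forall p q : R, (alpha <= p)%R -> (p < q)%R ->
    (q <= alpha + 1)%R -> good B C (9 / 2 ^+ n) p q.
  elim: n => [|n IH] p q ap pq qb.
    move=> v v0; rewrite expr0 divr1; apply: (le_trans (gweight_ub alpha0 alphaA v0 ap qb)).
    by rewrite leeDr// mule_ge0 ?lee_fin// gweight_ge0.
  have -> : (9 / 2 ^+ n.+1 = 9 / 2 ^+ n / 2 :> R)%R by rewrite exprSr invfM mulrA.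
  by apply: (good_halve alpha0 alphaA alphaB mB BT C0' full _ IH) => //; rewrite divr_ge0.
move=> p q ap pq qb; apply/lee_addgt0Pr => eps eps0.
have e9 : (0 < eps / 9)%R by rewrite divr_gt0.
have [n _ /(_ n (leqnn _)) /= en] := near_infty_natSinv_expn_lt (PosNum e9).
have w0 E : measurable E -> gweight (0 : R) E = mu E.
  move=> mE; rewrite -[RHS]mul1e -integral_cst//; apply: eq_integral => x _.
  by rewrite mul0r addr0 expr1n invr1.
have := good_n n p q ap pq qb 0%R (lexx _); rewrite !w0//.
rewrite lebesgue_measure_itv /= lte_fin pq -EFinB => h.
apply: (le_trans h); apply: leeD2l.
rewrite lee_fin addr0 expr1n divr1; move: en; lra.
Qed.

Lemma invariant_null : mu (B `&` `]alpha, (alpha + 1)%R[) = 0.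
Proof.
have [C C0 hC] := uniformly_missed.
have [N [mN N0 NB]] := lebesgue_density mB.
apply: (@measure_negligible _ _ _ mu) => //; first exact: measurableI.
exists N; split=> // x [Bx xab]; apply: NB => /= h.
move: xab; rewrite /= in_itv /= => /andP[ax xb].
suff : (\1_B x)%:E <= (1 - C^-1)%:E.
  have Ci : (0 < C^-1)%R by rewrite invr_gt0.
  by rewrite indicE mem_set//= lee_fin; lra.
apply: (cvge_to_le h).
near=> r.
have r0 : (0 < r)%R by near: r; exact: nbhs_right_gt.
have rx : (r <= x - alpha)%R by near: r; apply: nbhs_right_le; rewrite subr_gt0.
have ry : (r <= alpha + 1 - x)%R by near: r; apply: nbhs_right_le; rewrite subr_gt0.
rewrite (lebesgue_measure_ball _ (ltW r0)) inver mulrn_eq0 /= gt_eqF//.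
have /hC : (alpha <= x - r)%R by lra.
move=> /(_ (x + r)%R) hh.
have : ((x + r) - (x - r))%:E <= C%:E * mu (`](x - r)%R, (x + r)%R[ `\` B).
  by apply: hh; lra.
rewrite -ball_itv => hm {hh}.
have mb : mu (ball x r) = (r *+ 2)%:E by rewrite lebesgue_measure_ball// ltW.
have mball : measurable (ball x r) by exact: measurable_ball.
have fI : mu (B `&` ball x r) \is a fin_num.
  rewrite ge0_fin_numE//; apply: (@le_lt_trans _ _ (mu (ball x r)));
    last by rewrite mb ltry.
  by apply: le_measure; rewrite ?inE//; exact: measurableI.
have e1 : mu (ball x r) = mu (ball x r `\` B) + mu (ball x r `&` B).
  exact: measureDI.
have fD : mu (ball x r `\` B) \is a fin_num.
  rewrite ge0_fin_numE//; apply: (@le_lt_trans _ _ (mu (ball x r)));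
    last by rewrite mb ltry.
  by apply: le_measure; rewrite ?inE//; exact: measurableD.
move: e1 hm; rewrite mb [_ `&` B]setIC -(fineK fI) -(fineK fD) -!EFinD -!EFinM !lee_fin => -[e1] hm.
rewrite ler_pdivrMr ?mulrn_wgt0//.
have : (C^-1 * (r *+ 2) <= fine (mu (ball x r `\` B)))%R.
  by rewrite ler_pdivrMl//; move: hm; lra.
lra.
Unshelve. all: by end_near. Qed.

End invariant_sets_are_trivial.

(** * Uniqueness of the invariant measure *)

Lemma measurable_T (R : realType) (alpha : R) :
  measurable_fun [set: measurableTypeR R]
    (T alpha : measurableTypeR R -> measurableTypeR R).
Proof.
have m2 : measurable_fun [set: measurableTypeR R]
    (fun x : measurableTypeR R => (2 / x)%R : measurableTypeR R).
  by apply: measurable_funM => //; exact: measurable_inv.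
apply: measurable_funB => //.
apply: (measurableT_comp (@measurable_floor R)).
exact: measurable_funB.
Qed.

Lemma measurable_preimage d d' (X : measurableType d) (Y : measurableType d')
    (f : X -> Y) (E : set Y) :
  measurable_fun setT f -> measurable E -> measurable (f @^-1` E).
Proof. by move=> mf mE; rewrite -[_ @^-1` _]setTI; exact: mf. Qed.

Section comparison.
Context d (X : measurableType d) (R : realType) (mu nu : probability X R).
Notation n := (fun E => fine (nu E)).
Notation m := (fun E => fine (mu E)).

Lemma fineD_prob (P : probability X R) (A B : set X) :
  measurable A -> measurable B ->
  fine (P A) = fine (P (A `&` B)) + fine (P (A `\` B)).
Proof.
move=> mA mB; rewrite -fineD; last 2 first.
- by apply: fin_num_measure; exact: measurableI.
- by apply: fin_num_measure; exact: measurableD.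
congr fine; rewrite addeC; exact: measureDI.
Qed.

Lemma hahn_prob : exists P : set X, [/\ measurable P,
  forall A, measurable A -> A `<=` P -> m A <= n A &
  forall A, measurable A -> A `<=` ~` P -> n A <= m A].
Proof.
pose la := cadd (charge_of_finite_measure nu) (copp (charge_of_finite_measure mu)).
have laE A : measurable A -> la A = (n A - m A)%:E.
  move=> mA; rewrite /la /cadd /copp /= EFinB !fineK//; exact: fin_num_measure.
have [P [N [[mP posP] [mN negN] PN PN0]]] := Hahn_decomposition la.
exists P; split => // A mA AP.
  have : (0 <= la A)%E by exact: posP.
  by rewrite laE// lee_fin subr_ge0.
have AN : A `<=` N.
  by move=> x Ax; have : [set: X] x by []; rewrite -PN => -[/AP|].
have : (la A <= 0)%E by exact: negN.
by rewrite laE// lee_fin subr_le0.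
Qed.

End comparison.

Section uniqueness.
Context {R : realType}.
Notation leb := (@lebesgue_measure R).
Variable alpha : R.
Hypotheses (alpha0 : 0 < alpha) (alphaA : 2 < alpha ^+ 2 + 5 * alpha).
Hypothesis alphaB : alpha ^+ 2 + 2 * alpha < 1.

Local Notation T := (T alpha).
Local Notation MR := (measurableTypeR R).

Lemma acip_preimage (P : probability MR R) k (E : set MR) : acip alpha P ->
  measurable E -> P (iter k T @^-1` E) = P E.
Proof.
move=> [[mI PI _ inv] _].
have mk j (F : set MR) : measurable F -> measurable (iter j T @^-1` F).
  elim: j F => [//|j IH] F mF; rewrite (_ : _ @^-1` _ = iter j T @^-1` (T @^-1` F))//.
  by apply: IH; apply: measurable_preimage mF; exact: measurable_T.
have PIE (F : set MR) : measurable F -> P (`[alpha, alpha + 1] `&` F) = P F.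
  move=> mF; apply/eqP; rewrite eq_le; apply/andP; split.
    by apply: le_measure; rewrite ?inE//; exact: measurableI.
  have Pc : P (~` `[alpha, alpha + 1]) = 0%E.
    by rewrite probability_setC// PI subee.
  have FIc : P (F `\` `[alpha, alpha + 1]) = 0%E.
    apply: (@subset_measure0 _ _ _ P _ (~` `[alpha, alpha + 1])) => //.
    - exact: measurableD.
    - exact: measurableC.
  have -> : P F = (P (F `\` `[alpha, (alpha + 1)%R]) + P (F `&` `[alpha, (alpha + 1)%R]))%E.
    exact: measureDI.
  by rewrite FIc add0e setIC.
elim: k E => [//|k IH] E mE.
rewrite (_ : _ @^-1` _ = iter k T @^-1` (T @^-1` E))//.
have mTE : measurable (T @^-1` E : set MR).
  by apply: measurable_preimage mE; exact: measurable_T.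
by rewrite IH// -PIE// inv.
Qed.

Lemma acip_full (P : probability MR R) (E : set MR) : acip alpha P ->
  measurable E -> leb (`]alpha, (alpha + 1)%R[ `\` E) = 0%E -> P E = 1%E.
Proof.
move=> [[mI PI _ inv] PL] mE E0.
have nullP (F : set MR) : measurable F -> leb F = 0%E -> P F = 0%E.
  by move=> mF F0; exact: (null_content_dominatesP _ _).1 PL F mF F0.
apply/eqP; rewrite eq_le probability_le1//= -PI.
have mIE : measurable (`[alpha, alpha + 1] `\` E : set MR) by exact: measurableD.
have -> : P `[alpha, alpha + 1]%classic =
    (P (`[alpha, (alpha + 1)%R] `\` E) + P (`[alpha, (alpha + 1)%R] `&` E))%E.
  exact: measureDI.
rewrite [X in (X + _)%E]nullP//.
  by rewrite add0e; apply: le_measure; rewrite ?inE//; exact: measurableI.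
apply: (@subset_measure0 _ _ _ leb _
   ((`]alpha, (alpha + 1)%R[ `\` E) `|` ([set alpha] `|` [set (alpha + 1)%R]))) => //.
- by apply: measurableU; [exact: measurableD|exact: measurableU].
- move=> x [/= xI xE]; move: xI; rewrite in_itv /= => /andP[].
  rewrite !le_eqVlt => /predU1P[<-|ax]; first by right; left.
  move=> /predU1P[->|xb]; first by right; right.
  by left; split=> //=; rewrite in_itv /= ax.
- apply/eqP; rewrite eq_le measure_ge0 andbT.
  apply: (le_trans (measureU2 _ _ _)) => //; [exact: measurableD|exact: measurableU|].
  rewrite [X in (X + _)%E]E0 add0e le_eqVlt; apply/orP; left; apply/eqP.
  apply: countable_lebesgue_measure0; apply: finite_set_countable.
  by rewrite finite_setU; split; exact: finite_set1.
Qed.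

(** If the positive part [P] of [nu - mu] had positive mass, so would the set
    of points that never leave [P]: since both measures are invariant, [P] and
    its preimages differ by sets on which [nu] and [mu] agree. This set is
    mapped into itself, so it has full measure, and [nu - mu] has mass zero. *)
Theorem acip_unique (mu nu : probability MR R) (E : set MR) :
  acip alpha mu -> acip alpha nu -> measurable E -> nu E = mu E.
Proof.
move=> imu inu mE; have [P [mP posP negP]] := hahn_prob mu nu.
pose n A := fine (nu A); pose m A := fine (mu A).
have nE A : measurable A -> nu A = (n A)%:E.
  by move=> mA; rewrite /n fineK//; exact: fin_num_measure.
have mE' A : measurable A -> mu A = (m A)%:E.
  by move=> mA; rewrite /m fineK//; exact: fin_num_measure.
pose Q k : set MR := iter k T @^-1` P.
have mQ k : measurable (Q k).
  rewrite /Q; elim: k P mP {posP negP Q} => [//|k IH] F mF.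
  rewrite (_ : _ @^-1` _ = iter k T @^-1` (T @^-1` F))//.
  by apply: IH; apply: measurable_preimage mF; exact: measurable_T.
have eqD k : n (P `\` Q k) = m (P `\` Q k).
  have nD := fineD_prob nu; have mD := fineD_prob mu.
  have n1 := nD _ _ mP (mQ k); have n2 := nD _ _ (mQ k) mP.
  have m1 := mD _ _ mP (mQ k); have m2 := mD _ _ (mQ k) mP.
  have nQ : fine (nu (Q k)) = fine (nu P) by rewrite acip_preimage.
  have mQ' : fine (mu (Q k)) = fine (mu P) by rewrite acip_preimage.
  have h1 : m (P `\` Q k) <= n (P `\` Q k).
    by apply: posP; [exact: measurableD|move=> x []].
  have h2 : n (Q k `\` P) <= m (Q k `\` P).
    by apply: negP; [exact: measurableD|move=> x []].
  move: n1 n2 m1 m2 h1 h2; rewrite nQ mQ' [Q k `&` P]setIC /n /m; lra.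
pose D k := P `\` Q k.
have mD k : measurable (D k) by exact: measurableD.
have eqDU : nu (\bigcup_k D k) = mu (\bigcup_k D k).
  have mU : measurable (\bigcup_k seqDU D k).
    by apply: bigcupT_measurable => k; exact: seqDU_measurable.
  have sumE (p : probability MR R) :
      p (\bigcup_k D k) = (\sum_(0 <= k <oo) p (seqDU D k))%E.
    rewrite seqDU_bigcup_eq; apply: measure_semi_bigcup => //.
    exact: seqDU_measurable.
  rewrite !sumE.
  apply: eq_eseriesr => k _.
  have mS : measurable (seqDU D k) by exact: seqDU_measurable.
  have SD : seqDU D k `<=` D k by exact: subDsetl.
  have DP : D k `<=` P by exact: subDsetl.
  rewrite nE// mE'//; congr EFin; apply/eqP; rewrite eq_le; apply/andP; split;
    last by apply: posP => //; exact: subset_trans DP.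
  have := posP (D k `\` seqDU D k) (measurableD (mD k) mS)
    (subset_trans (@subDsetl _ _ _) DP).
  have := fineD_prob nu (mD k) mS; have := fineD_prob mu (mD k) mS.
  rewrite setIidr//; move: (eqD k); rewrite /n /m /D; lra.
pose B : set MR := \bigcap_k Q k.
have mB : measurable B by exact: bigcapT_measurable.
have BP : B `<=` P by move=> x /(_ 0%N I).
have PB : P `\` B = \bigcup_k D k.
  apply/seteqP; split=> x.
    move=> [Px nB]; apply: contrapT => nD; apply: nB => k _.
    by apply: contrapT => nQ; apply: nD; exists k.
  move=> [k _ [Px nQ]]; split=> // /(_ k I); exact: nQ.
have nPm : n P - m P = n B - m B.
  have := fineD_prob nu mP mB; have := fineD_prob mu mP mB.
  rewrite PB eqDU setIidr// /n /m; lra.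
have BT x : alpha < x < alpha + 1 -> B x -> B (T x).
  by move=> _ Bx k _; rewrite /Q /= -iterSr; exact: Bx.
have eqB : n B = m B.
  have [h|h] := eqVneq (leb (`]alpha, (alpha + 1)%R[ `\` B)) 0%E.
    by rewrite /n /m !acip_full.
  have B0 := invariant_null alpha0 alphaA alphaB mB BT h.
  have : leb (`]alpha, (alpha + 1)%R[ `\` ~` B) = 0%E by rewrite setDE setCK setIC.
  move=> /acip_full full.
  have nB := full nu inu (measurableC mB); have mB' := full mu imu (measurableC mB).
  have := fineD_prob nu measurableT mB; have := fineD_prob mu measurableT mB.
  rewrite !setTI !setTD nB mB' !probability_setT /n /m /=; lra.
have eqP : n P = m P by lra.
have sub0 (S F : set MR) : measurable S -> measurable F -> n S = m S ->
    (forall A, measurable A -> A `<=` S -> m A <= n A) \/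
    (forall A, measurable A -> A `<=` S -> n A <= m A) -> n (S `&` F) = m (S `&` F).
  move=> mS mF eqS h.
  have := fineD_prob nu mS mF; have := fineD_prob mu mS mF.
  have mI : measurable (S `&` F) by exact: measurableI.
  have mD' : measurable (S `\` F) by exact: measurableD.
  move: eqS; rewrite /n /m => eqS e1 e2.
  have [{}h|{}h] := h.
    by have := h _ mI (@subIsetl _ _ _); have := h _ mD' (@subDsetl _ _ _); rewrite /n /m; lra.
  by have := h _ mI (@subIsetl _ _ _); have := h _ mD' (@subDsetl _ _ _); rewrite /n /m; lra.
have eqPc : n (~` P) = m (~` P).
  have := fineD_prob nu measurableT mP; have := fineD_prob mu measurableT mP.
  by move: eqP; rewrite !setTI !setTD !probability_setT /n /m /=; lra.
rewrite nE// mE'//; congr EFin.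
have := fineD_prob nu mE mP; have := fineD_prob mu mE mP.
have := sub0 _ _ mP mE eqP (or_introl posP).
have := sub0 _ _ (measurableC mP) mE eqPc (or_intror negP).
by rewrite !setDE ![E `&` _]setIC /n /m; lra.
Qed.

End uniqueness.

(** * Constants and break points *)

Section constants.
Context {R : realType}.

Lemma sqrt2_bounds : 1414 / 1000 < Num.sqrt (2 : R) < 1415 / 1000.
Proof.
have s2 : Num.sqrt (2 : R) * Num.sqrt 2 = 2 by rewrite -expr2 sqr_sqrtr.
have s0 : 0 <= Num.sqrt (2 : R) by exact: sqrtr_ge0.
by apply/andP; split; rewrite ltNge; apply/negP => h; nra.
Qed.

Lemma sqrt33_bounds : 5744 / 1000 < Num.sqrt (33 : R) < 5745 / 1000.
Proof.
have s2 : Num.sqrt (33 : R) * Num.sqrt 33 = 33 by rewrite -expr2 sqr_sqrtr.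
have s0 : 0 <= Num.sqrt (33 : R) by exact: sqrtr_ge0.
by apply/andP; split; rewrite ltNge; apply/negP => h; nra.
Qed.

Lemma cA_bounds : 372 / 1000 < cA R < 373 / 1000.
Proof.
by have /andP[h1 h2] := sqrt33_bounds; rewrite /cA; apply/andP; split; lra.
Qed.

Lemma cB_bounds : 414 / 1000 < cB R < 415 / 1000.
Proof.
by have /andP[h1 h2] := sqrt2_bounds; rewrite /cB; apply/andP; split; lra.
Qed.

Lemma cA_eq : cA R ^+ 2 + 5 * cA R = 2.
Proof.
have s2 : Num.sqrt (33 : R) ^+ 2 = 33 by rewrite sqr_sqrtr.
rewrite /cA; transitivity ((Num.sqrt (33 : R) ^+ 2 - 25) / 4); first by field.
by rewrite s2; field.
Qed.

Lemma cB_eq : cB R ^+ 2 + 2 * cB R = 1.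
Proof.
have s2 : Num.sqrt (2 : R) ^+ 2 = 2 by rewrite sqr_sqrtr.
rewrite /cB; transitivity (Num.sqrt (2 : R) ^+ 2 - 1); first by ring.
by rewrite s2; ring.
Qed.

Lemma cC_eq : cC R = (cA R + 1) / 3. Proof. by rewrite /cC /cA; field. Qed.
Lemma cD_eq : cD R = 2 * cB R. Proof. by rewrite /cD /cB; ring. Qed.
Lemma cE_eq : cE R = cA R + 1. Proof. by rewrite /cE /cA; field. Qed.
Lemma cF_eq : cF R = cB R + 1. Proof. by rewrite /cF /cB; ring. Qed.

Lemma constants_order :
  [/\ 0 < cA R, cA R < cB R, cB R < cC R, cC R < cD R & cD R < cE R /\ cE R < cF R].
Proof.
have /andP[a1 a2] := cA_bounds; have /andP[b1 b2] := cB_bounds.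
by rewrite cC_eq cD_eq cE_eq cF_eq; repeat split; lra.
Qed.

(** The heights of the rectangles of the natural extension satisfy the relations
    that make the images of the rectangles fit together. *)
Lemma heights : [/\ 2 / cB R = 4 + cD R, 2 / cA R = 4 + cE R,
  2 / cC R = 3 + cE R, 2 / cD R = 2 + cB R &
  2 / cE R = 1 + cC R /\ 2 / cF R = 1 + cB R].
Proof.
have /andP[a1 a2] := cA_bounds; have /andP[b1 b2] := cB_bounds.
have a := cA_eq; have b := cB_eq; rewrite cC_eq cD_eq cE_eq cF_eq.
have eqE (x y : R) : 0 < y -> x * y = 2 -> 2 / y = x.
  by move=> y0 <-; rewrite mulfK// gt_eqF.
by repeat split; apply: eqE; nra.
Qed.

End constants.

Section break_points.
Context {R : realType}.
Variable alpha : R.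
Hypothesis alphaAB : cA R < alpha < cB R.

Lemma alpha_gt0 : 0 < alpha.
Proof. by have [? ? _ _ _] := @constants_order R; case/andP: alphaAB; lra. Qed.

Lemma alpha_A : 2 < alpha ^+ 2 + 5 * alpha.
Proof.
have a := @cA_eq R; have [A0 _ _ _ _] := @constants_order R.
by case/andP: alphaAB => h1 h2; nra.
Qed.

Lemma alpha_B : alpha ^+ 2 + 2 * alpha < 1.
Proof.
have b := @cB_eq R; have a0 := alpha_gt0.
by case/andP: alphaAB => h1 h2; nra.
Qed.

Definition bTa : R := 2 / alpha - 4.
Definition bTb : R := (1 - alpha) / (1 + alpha).
Definition bTTa : R := (3 * alpha - 1) / (1 - 2 * alpha).
Definition bTTb : R := (6 * alpha - 2) / (1 - alpha).

Let a0 := alpha_gt0.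
Let aA := alpha_A.
Let aB := alpha_B.
Let a37 := alpha_gt a0 aA.
Let a41 := alpha_lt aB.

Lemma break_points_order : [/\ alpha < bTb, bTb < bTTa, bTTa < alpha + 1,
  alpha < bTTb & bTTb < bTa /\ bTa < alpha + 1].
Proof.
move: a0 aA aB a37 a41 => h0 hA hB h37 h41.
rewrite /bTa /bTb /bTTa /bTTb; split.
- by rewrite ltr_pdivlMr; nra.
- rewrite ltr_pdivrMr; last by lra.
  by rewrite mulrAC ltr_pdivlMr; nra.
- by rewrite ltr_pdivrMr; nra.
- by rewrite ltr_pdivlMr; nra.
- split.
    rewrite ltr_pdivrMr; last by lra.
    rewrite mulrBl mulrAC ltrBrDr ltr_pdivlMr//; nra.
  by rewrite ltrBlDr ltr_pdivrMr//; nra.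
Qed.

(** Since [2 / bTTb] and [2 / bTTa] differ by one, the orbits of the two end
    points merge after three steps; this is what makes the region finite. *)
Lemma break_points_inv : [/\ 2 / bTb = bTTb + 4, 2 / bTa = bTTa + 1 &
  2 / bTTb = 2 / bTTa + 1].
Proof.
move: a0 a37 a41 => h0 h37 h41; rewrite /bTa /bTb /bTTa /bTTb.
have e1 : 1 + alpha != 0 by apply: lt0r_neq0; lra.
have e2 : 1 - alpha != 0 by apply: lt0r_neq0; lra.
have e3 : 1 - 2 * alpha != 0 by apply: lt0r_neq0; lra.
have e4 : 3 * alpha - 1 != 0 by apply: lt0r_neq0; lra.
have e5 : 6 * alpha - 2 != 0 by apply: lt0r_neq0; lra.
have e6 : alpha != 0 by apply: lt0r_neq0.
have -> : 2 / alpha - 4 = 2 * (1 - 2 * alpha) / alpha by field.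
have e7 : 6 * alpha - 2 = 2 * (3 * alpha - 1) by ring.
split.
- by field; rewrite e1 e2.
- by field; rewrite e3 e6.
- by rewrite e7; field; rewrite e2 e3 e4.
Qed.

Lemma break_points_T : [/\ T alpha alpha = bTa, T alpha (alpha + 1) = bTb,
  iter 2 (T alpha) alpha = bTTa & iter 2 (T alpha) (alpha + 1) = bTTb].
Proof.
have [p1 p2 p3 p4 [p5 p6]] := break_points_order.
have [i1 i2 i3] := break_points_inv.
have h0 := a0.
have Ta : T alpha alpha = bTa.
  by rewrite (@T_branch _ _ 4)// -/bTa p6 ltW// (lt_trans p4).
have bE : 2 / (alpha + 1) - 1%:R = bTb.
  by rewrite /bTb; field; rewrite gt_eqF//; lra.
have Tb : T alpha (alpha + 1) = bTb.
  by rewrite (@T_branch _ _ 1) bE// (ltW p1) (lt_trans p2).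
split=> //=; rewrite ?Ta ?Tb.
- have e : 2 / bTa - 1%:R = bTTa by rewrite i2; ring.
  by rewrite (@T_branch _ _ 1) e// p3 andbT ltW// (lt_trans p1).
- have e : 2 / bTb - 4%:R = bTTb by rewrite i1; ring.
  by rewrite (@T_branch _ _ 4) e// (ltW p4) (lt_trans p5).
Qed.

(** * The tiling *)

(** The two boundaries, with arbitrary values at the break points. *)
Definition low (x : R) : R := if x < bTTb then cA R else if x < bTa then cB R else cC R.
Definition upp (x : R) : R := if x < bTb then cD R else if x < bTTa then cE R else cF R.

Lemma low_gt0 x : 0 < low x.
Proof.
by have [? ? ? ? [? ?]] := @constants_order R; rewrite /low; do 2 ?case: ifP => _; lra.
Qed.

Lemma low_lt_upp x : low x < upp x.
Proof.
have [? ? ? ? [? ?]] := @constants_order R.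
by rewrite /low /upp; do 4 ?case: ifP => _; lra.
Qed.

Definition pre (d x : R) : R := 2 / (d + x).

Lemma pre_lt (d x c : R) : 0 < d + x -> 0 < c -> (pre d x < c) = (2 / c - d < x).
Proof.
move=> dx c0; rewrite /pre ltr_pdivrMr// ltrBlDr ltr_pdivrMr//.
by rewrite mulrC [x + d]addrC.
Qed.

Lemma pre_gt (d x c : R) : 0 < d + x -> 0 < c -> (c < pre d x) = (x < 2 / c - d).
Proof.
move=> dx c0; rewrite /pre ltr_pdivlMr// ltrBrDr ltr_pdivlMr//.
by rewrite mulrC [x + d]addrC.
Qed.

Section tiling.
Variable x : R.
Hypothesis xI : alpha < x < alpha + 1.

Let dx0 (d : R) : 0 <= d -> 0 < d + x.
Proof. by case/andP: xI => h _; move: a0 => ? ?; lra. Qed.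

Let x1 : alpha < x. Proof. by case/andP: xI. Qed.
Let x2 : x < alpha + 1. Proof. by case/andP: xI. Qed.

Let end_points_inv : 2 / (alpha + 1) = bTb + 1 /\ 2 / alpha = bTa + 4.
Proof.
move: a0 => h0; split; last by rewrite /bTa; ring.
by rewrite /bTb; field; rewrite addrC gt_eqF//; lra.
Qed.

Let break_points_far : [/\ alpha + 2 <= 2 / bTTb, bTb + 2 <= 2 / bTTb,
  2 / bTTa <= alpha + 4 & 2 / bTTa < bTa + 3].
Proof.
move: a0 aA aB a37 a41 => h0 hA hB h37 h41.
have [p1 p2 p3 p4 _] := break_points_order.
have [_ _ i3] := break_points_inv.
have e1 : 1 - 2 * alpha != 0 by apply: lt0r_neq0; lra.
have e2 : 3 * alpha - 1 != 0 by apply: lt0r_neq0; lra.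
have e3 : 2 / bTTa = (2 - 4 * alpha) / (3 * alpha - 1).
  by rewrite /bTTa; field; rewrite e1 e2.
rewrite i3 e3 /bTb /bTa; split.
- by rewrite -lerBlDr ler_pdivlMr; nra.
- rewrite -lerBlDr -addrA -lerBrDr ler_pdivrMr; last by lra.
  rewrite mulrBl mulrAC lerBrDr ler_pdivlMr; nra.
- by rewrite ler_pdivrMr; nra.
- rewrite ltr_pdivrMr; last by lra.
  rewrite (_ : 2 / alpha - 4 + 3 = (2 - alpha) / alpha); last by field; rewrite gt_eqF.
  by rewrite mulrAC ltr_pdivlMr//; nra.
Qed.

Lemma pre_inside : [/\ alpha < pre 2 x < alpha + 1, alpha < pre 3 x < alpha + 1,
  (alpha < pre 1 x < alpha + 1) = (bTb < x) &
  (alpha < pre 4 x < alpha + 1) = (x < bTa)].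
Proof.
have [p1 p2 p3 p4 [p5 p6]] := break_points_order.
have [iB iA] := end_points_inv; have b0 : 0 < alpha + 1 by move: a0; lra.
split; rewrite pre_gt ?pre_lt ?dx0// iB iA.
- by apply/andP; split; move: x1 x2; lra.
- by apply/andP; split; move: x1 x2; lra.
- rewrite addrK; have -> : x < bTa + 4 - 1 by move: x1 x2; lra.
  by [].
- rewrite addrK andbC; have -> : bTb + 1 - 4 < x by move: x1 x2; lra.
  by [].
Qed.

Let bpos : [/\ 0 < bTb, 0 < bTTa, 0 < bTTb & 0 < bTa].
Proof.
have [p1 p2 p3 p4 [p5 p6]] := break_points_order.
by split; move: a0; lra.
Qed.

(** Both sides change their value at the same [x], because the break points
    [bTTa] and [bTTb] are related by [break_points_inv]. *)
Lemma tile_step (k : nat) : (1 <= k <= 3)%N ->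
  k%:R + upp (pre k%:R x) = k.+1%:R + low (pre k.+1%:R x).
Proof.
move=> /andP[k1 k3]; have [b1 b2 b3 b4] := bpos.
have [p1 p2 p3 p4 [p5 p6]] := break_points_order.
have [i1 i2 i3] := break_points_inv.
have k1' : 1 <= k%:R :> R by rewrite ler1n.
have k3' : k%:R <= 3 :> R by rewrite ler_nat.
have kS : k.+1%:R = k%:R + 1 :> R by rewrite natr1.
rewrite kS /upp /low !pre_lt ?dx0 ?addr_ge0// i1 i2 i3.
rewrite ifF; last by apply/negbTE; rewrite -leNgt; move: x2; lra.
rewrite (_ : 2 / bTTa + 1 - (k%:R + 1) = 2 / bTTa - k%:R); last by ring.
case: ifPn => _; first by rewrite cE_eq; ring.
rewrite ifT; last by move: x1; lra.
by rewrite cF_eq; ring.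
Qed.

(** The lowest tile on the axis of [2 / y] starts where the fibre does. *)
Lemma tile_top : x != bTb -> x != bTTa ->
  2 / upp x = if bTb < x then 1 + low (pre 1 x) else 2 + low (pre 2 x).
Proof.
move=> xb xn; have [b1 b2 b3 b4] := bpos.
have [p1 p2 p3 p4 [p5 p6]] := break_points_order.
have [i1 i2 i3] := break_points_inv.
have [f1 f2 f3 f4] := break_points_far.
have [h1 h2 h3 h4 [h5 h6]] := @heights R.
move: x1 x2 => y1 y2; rewrite /upp /low !pre_lt ?dx0// i2.
case: (ltgtP bTb x) xb => // xb _.
  rewrite [X in _ = _ + X]ifF; last by apply/negbTE; rewrite -leNgt; lra.
  by rewrite addrK; case: (ltgtP x bTTa) xn.
rewrite [X in _ = _ + X]ifF; last by apply/negbTE; rewrite -leNgt; lra.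
by rewrite [X in _ = _ + X]ifT//; lra.
Qed.

(** The highest tile on the axis of [2 / y] ends where the fibre does. *)
Lemma tile_bot : x != bTTb ->
  2 / low x = if x < bTa then 4 + upp (pre 4 x) else 3 + upp (pre 3 x).
Proof.
move=> xn; have [b1 b2 b3 b4] := bpos.
have [p1 p2 p3 p4 [p5 p6]] := break_points_order.
have [i1 i2 i3] := break_points_inv.
have [f1 f2 f3 f4] := break_points_far.
have [h1 h2 h3 h4 [h5 h6]] := @heights R.
move: x1 x2 => y1 y2; rewrite /upp /low !pre_lt ?dx0// i1.
have [xa|xa] := ltP x bTa.
  rewrite addrK; case: (ltgtP x bTTb) xn => // _ _.
  by rewrite [X in _ = _ + X]ifT//; lra.
rewrite ifF; last by apply/negbTE; rewrite -leNgt; lra.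
rewrite [X in _ = _ + X]ifF; last by apply/negbTE; rewrite -leNgt; lra.
by rewrite [X in _ = _ + X]ifT//; lra.
Qed.

Hypotheses (xTb : x != bTb) (xTTa : x != bTTa) (xTTb : x != bTTb).

(** The fibre over [x] meets the image of the branch of digit [k] at
    [2 / (k + w)] exactly if the preimage [(pre k x, w)] is in the region. *)
Definition in_tile (k : nat) (w : R) :=
  [/\ (1 <= k <= 4)%N, alpha < pre k%:R x < alpha + 1 &
      low (pre k%:R x) < w < upp (pre k%:R x)].

Let steps : [/\ 1 + upp (pre 1 x) = 2 + low (pre 2 x),
  2 + upp (pre 2 x) = 3 + low (pre 3 x) & 3 + upp (pre 3 x) = 4 + low (pre 4 x)].
Proof.
by have := @tile_step 1 isT; have := @tile_step 2 isT; have := @tile_step 3 isT.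
Qed.

Let inv_fibre (t : R) : 0 < t ->
  (low x < 2 / t < upp x) = (2 / upp x < t < 2 / low x).
Proof.
move=> t0; have l0 := low_gt0 x; have u0 := lt_trans l0 (low_lt_upp x).
by rewrite !ltr_pdivlMr// !ltr_pdivrMr// andbC [t * _]mulrC [t * _]mulrC.
Qed.

Lemma tile_forward k w : in_tile k w -> low x < 2 / (k%:R + w) < upp x.
Proof.
move=> [k14 kI /andP[w1 w2]].
rewrite inv_fibre; last by rewrite ltr_wpDl// (lt_trans (low_gt0 _) w1).
have [s1 s2 s3] := steps; have [_ _ p1 p4] := pre_inside.
have l1 := low_lt_upp (pre 1 x); have l2 := low_lt_upp (pre 2 x).
have l3 := low_lt_upp (pre 3 x); have l4 := low_lt_upp (pre 4 x).
rewrite tile_top// tile_bot//.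
case: k k14 kI w1 w2 => [|[|[|[|[|k]]]]]// _ kI w1 w2.
- by rewrite p1 in kI; rewrite kI; apply/andP; split; do ?case: ifP => _; lra.
- by apply/andP; split; do ?case: ifP => _; lra.
- by apply/andP; split; do ?case: ifP => _; lra.
- by rewrite p4 in kI; rewrite kI; apply/andP; split; do ?case: ifP => _; lra.
Qed.

Lemma tile_unique k j z : in_tile k (z - k%:R) -> in_tile j (z - j%:R) -> k = j.
Proof.
move=> [k14 _ /andP[k1 k2]] [j14 _ /andP[j1 j2]].
have [s1 s2 s3] := steps.
have l1 := low_lt_upp (pre 1 x); have l2 := low_lt_upp (pre 2 x).
have l3 := low_lt_upp (pre 3 x); have l4 := low_lt_upp (pre 4 x).
case: k k14 k1 k2 => [|[|[|[|[|k]]]]]// _ k1 k2;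
  case: j j14 j1 j2 => [|[|[|[|[|j]]]]]// _ j1 j2; exfalso; lra.
Qed.

Lemma tile_exists z : 2 / upp x < z < 2 / low x ->
  (forall k : nat, z - k%:R \notin [:: cA R; cB R; cC R; cD R; cE R; cF R]) ->
  exists k, in_tile k (z - k%:R).
Proof.
move=> /andP[zu zl] gen.
have low_gen t : low t \in [:: cA R; cB R; cC R; cD R; cE R; cF R].
  by rewrite /low !inE; do 2 ?case: ifP => _; rewrite eqxx ?orbT.
have neq (k : nat) : z != k%:R + low (pre k%:R x).
  apply/eqP => zE; have := gen k; rewrite zE addrAC subrr add0r.
  by rewrite low_gen.
have [I2 I3 p1 p4] := pre_inside; have [s1 s2 s3] := steps.
have n2 := neq 2%N; have n3 := neq 3%N; have n4 := neq 4%N; have n1 := neq 1%N.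
rewrite tile_top// in zu; rewrite tile_bot// in zl.
have in1 : bTb < x -> 1 + low (pre 1 x) < z -> z < 2 + low (pre 2 x) ->
    exists k, in_tile k (z - k%:R).
  by move=> xb h1 h2; exists 1%N; split=> //; [rewrite p1|apply/andP; split; lra].
have in2 : 2 + low (pre 2 x) < z -> z < 3 + low (pre 3 x) ->
    exists k, in_tile k (z - k%:R).
  by move=> h1 h2; exists 2%N; split=> //; apply/andP; split; lra.
have in3 : 3 + low (pre 3 x) < z -> z < 3 + upp (pre 3 x) ->
    exists k, in_tile k (z - k%:R).
  by move=> h1 h2; exists 3%N; split=> //; apply/andP; split; lra.
have in4 : x < bTa -> 4 + low (pre 4 x) < z -> z < 4 + upp (pre 4 x) ->
    exists k, in_tile k (z - k%:R).
  by move=> xa h1 h2; exists 4%N; split=> //; [rewrite p4|apply/andP; split; lra].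
case: (ltgtP z (2 + low (pre 2 x))) n2 => // z2 _.
  by case: ifP zu => [xb zu|_ zu]; [exact: in1|lra].
case: (ltgtP z (3 + low (pre 3 x))) n3 => // z3 _; first exact: in2.
case: (ltgtP z (4 + low (pre 4 x))) n4 => // z4 _; first by apply: in3 => //; lra.
by case: ifP zl => [xa zl|_ zl]; [exact: in4|lra].
Qed.

End tiling.

End break_points.

(** * The map on generic points *)

Section generic_points.
Context {R : realType}.

(** All points obtained from [S] by [x -> 2 / x], [x -> x + 1] and
    [x -> x - 1]. This countable set is stable under all the branches of both
    coordinates of the map and under their inverses, so that removing it leaves
    a domain on which the map is a bijection. *)
Definition moebius_step (m : option bool) (x : R) : R :=
  match m with None => 2 / x | Some true => x + 1 | Some false => x - 1 end.

Definition moebius_orbit (S : set R) : set R :=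
  \bigcup_(s in S) range (fun w : seq (option bool) => foldr moebius_step s w).

Variable S : set R.
Local Notation orb := (moebius_orbit S).

Lemma moebius_orbit_sub : S `<=` orb.
Proof. by move=> s Ss; exists s => //; exists [::]. Qed.

Lemma moebius_orbit_step m x : orb x -> orb (moebius_step m x).
Proof. by move=> [s Ss [w _ <-]]; exists s => //; exists (m :: w). Qed.

Lemma moebius_orbitD (k : nat) x : orb (x + k%:R) <-> orb x.
Proof.
elim: k => [|k IH]; first by rewrite addr0.
rewrite -IH -natr1 addrA; split=> [/(@moebius_orbit_step (Some false))|].
  by rewrite /= addrK.
exact: (@moebius_orbit_step (Some true)).
Qed.

Lemma moebius_orbitB (k : nat) x : orb (x - k%:R) <-> orb x.
Proof. by rewrite -(moebius_orbitD k (x - k%:R)) subrK. Qed.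

Lemma moebius_orbit_inv x : orb (2 / x) <-> orb x.
Proof.
split=> [/(@moebius_orbit_step None)|]; last exact: (@moebius_orbit_step None).
by rewrite /= invfM invrK mulrA divff// mul1r.
Qed.

Lemma moebius_orbit_countable : countable S -> countable orb.
Proof.
move=> cS; apply: bigcup_countable => // s _.
apply: (card_le_trans (card_image_le _ _)); exact: countableP.
Qed.

End generic_points.

Section natural_extension_map.
Context {R : realType}.
Variable alpha : R.
Hypothesis alphaAB : cA R < alpha < cB R.
Variable S : set R.

Local Notation bTa := (bTa alpha).
Local Notation bTb := (bTb alpha).
Local Notation bTTa := (bTTa alpha).
Local Notation bTTb := (bTTb alpha).
Local Notation low := (low alpha).
Local Notation upp := (upp alpha).

Let a0 := alpha_gt0 alphaAB.
Let aA := alpha_A alphaAB.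
Let aB := alpha_B alphaAB.

(** The heights are included because second coordinates on the boundary of the
    region must be excluded as well. *)
Definition exceptional : set R :=
  S `|` [set` [:: alpha; alpha + 1; bTa; bTb; bTTa; bTTb;
                 cA R; cB R; cC R; cD R; cE R; cF R]].

Local Notation orb := (moebius_orbit exceptional).

Definition generic : set (R * R) := [set z |
  [/\ alpha < z.1 < alpha + 1, low z.1 < z.2 < upp z.1, ~ orb z.1 & ~ orb z.2]].

Let orb_exc x : x \in [:: alpha; alpha + 1; bTa; bTb; bTTa; bTTb;
  cA R; cB R; cC R; cD R; cE R; cF R] -> orb x.
Proof. by move=> xl; apply: moebius_orbit_sub; right. Qed.

Let orb_neq x c : ~ orb x -> c \in [:: alpha; alpha + 1; bTa; bTb; bTTa; bTTb;
  cA R; cB R; cC R; cD R; cE R; cF R] -> x != c.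
Proof. by move=> xg cl; apply/eqP => xc; apply: xg; rewrite xc; exact: orb_exc. Qed.

Definition in_branch (k : nat) (x : R) := alpha <= 2 / x - k%:R < alpha + 1.

Lemma digit_exists x : alpha < x < alpha + 1 ->
  exists2 k : nat, (1 <= k <= 4)%N & in_branch k x.
Proof.
move=> /andP[ax xb]; have x0 : 0 < x by exact: lt_trans ax.
have h (d : nat) : cut alpha d.+1 < x -> x <= cut alpha d -> in_branch d x.
  move=> c1 c2; rewrite /in_branch -le_cut// c2 /=.
  by rewrite ltNge; apply/negP => c3; move: c1; rewrite ltNge le_cut// -natr1; apply/negP; rewrite negbK; move: c3; lra.
have [x4|x4] := leP x (cut alpha 4).
  by exists 4%N => //; apply: h => //; exact: le_lt_trans (cut5_le a0 aA) ax.
have [x3|x3] := leP x (cut alpha 3); first by exists 3%N => //; exact: h.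
have [x2|x2] := leP x (cut alpha 2); first by exists 2%N => //; exact: h.
by exists 1%N => //; apply: h => //; exact: le_trans (ltW xb) (le_cut1 a0 aB).
Qed.

Lemma in_branch_inj j k x : in_branch j x -> in_branch k x -> j = k.
Proof.
move=> /andP[j1 j2] /andP[k1 k2]; apply/eqP; rewrite eqn_leq; apply/andP; split.
  by rewrite -ltnS -(ltr_nat R) -natr1; lra.
by rewrite -ltnS -(ltr_nat R) -natr1; lra.
Qed.

Lemma calT_branch k z : in_branch k z.1 ->
  calT alpha z = (2 / z.1 - k%:R, 2 / (k%:R + z.2)).
Proof.
move=> kz; rewrite /calT (T_branch kz) /d1 (@floor_def _ _ k%:Z)//.
by case/andP: kz => h1 h2; rewrite rmorphD /=; apply/andP; split; lra.
Qed.

Lemma generic_branch k z : (1 <= k <= 4)%N -> in_branch k z.1 -> generic z ->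
  [/\ generic (calT alpha z), branch_inv k%:R (calT alpha z) = z &
      in_tile alpha (calT alpha z).1 k z.2].
Proof.
move=> k14 kz [zI zlu g1 g2]; rewrite (calT_branch kz).
have /andP[z1 z2] := zI; have z0 : 0 < z.1 by exact: lt_trans z1.
have y0 : 0 < z.2 by case/andP: zlu => + _; exact: lt_trans (low_gt0 _ _).
have k0 : 0 < k%:R :> R by rewrite ltr0n; case/andP: k14.
set x' := 2 / z.1 - k%:R; have gx' : ~ orb x'.
  by move=> /moebius_orbitB/moebius_orbit_inv.
have x'I : alpha < x' < alpha + 1.
  case/andP: kz => h1 ->; rewrite andbT lt_neqAle h1 andbT eq_sym.
  by apply: orb_neq => //; rewrite !inE eqxx.
have preE : pre k%:R x' = z.1.
  by rewrite /pre /x' addrC subrK invfM invrK mulrA divff// mul1r.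
have tile : in_tile alpha x' k z.2 by rewrite /in_tile preE.
have gy' : ~ orb (2 / (k%:R + z.2)).
  by move=> /moebius_orbit_inv; rewrite addrC => /moebius_orbitD.
split => //.
  split=> //=; apply: (@tile_forward _ _ alphaAB x') => //;
    by apply: orb_neq => //; rewrite !inE eqxx ?orbT.
rewrite /branch_inv /= -/(pre _ _) preE.
by rewrite invfM invrK mulrA divff// mul1r addrC addKr; case: (z).
Qed.

Lemma generic_preimage z : generic z ->
  exists k : nat, [/\ (1 <= k <= 4)%N, generic (branch_inv k%:R z),
    in_branch k (branch_inv k%:R z).1 & calT alpha (branch_inv k%:R z) = z].
Proof.
move=> [zI zlu g1 g2]; have /andP[z1 z2] := zI.
have y0 : 0 < z.2 by case/andP: zlu => + _; exact: lt_trans (low_gt0 _ _).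
have u0 := lt_trans (low_gt0 alpha z.1) (low_lt_upp alpha z.1).
have zlu' : 2 / upp z.1 < 2 / z.2 < 2 / low z.1.
  case/andP: zlu => h1 h2.
  by rewrite !ltr_pM2l// !ltf_pV2 ?posrE// ?low_gt0// h1 h2.
have [k kt] : exists k, in_tile alpha z.1 k (2 / z.2 - k%:R).
  apply: (tile_exists alphaAB zI) => //;
    [by apply: orb_neq => //; rewrite !inE eqxx ?orbT..|].
  move=> k; apply/negP => zc; apply: g2.
  apply: (moebius_orbit_inv _ _).1; apply: (moebius_orbitB _ k _).1.
  apply: orb_exc.
  by move: zc; rewrite !inE => /or4P[->|->|->|/or3P[->|->|->]]; rewrite ?orbT.
exists k; case: kt => k14 kI kw.
have kz0 : 0 < k%:R + z.1 by rewrite ltr_wpDl// (lt_trans a0).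
have preE : 2 / (2 / (k%:R + z.1)) - k%:R = z.1.
  by rewrite invfM invrK mulrA divff// mul1r addrC addKr.
have kb : in_branch k (branch_inv k%:R z).1.
  by rewrite /in_branch /= preE (ltW z1) z2.
split=> //.
  split=> //=.
    by move=> /moebius_orbit_inv; rewrite addrC => /moebius_orbitD.
  by move=> /moebius_orbitB/moebius_orbit_inv.
rewrite (calT_branch kb) /= preE addrC subrK invfM invrK mulrA divff// mul1r.
by case: (z).
Qed.

Lemma calT_generic z : generic z -> generic (calT alpha z).
Proof.
move=> gz; have [zI _ _ _] := gz; have [k k14 kz] := digit_exists zI.
by have [] := generic_branch k14 kz gz.
Qed.

Lemma calT_generic_inj z w : generic z -> generic w ->
  calT alpha z = calT alpha w -> z = w.
Proof.
move=> gz gw zw; have [zI _ _ _] := gz; have [wI _ _ _] := gw.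
have [k k14 kz] := digit_exists zI; have [j j14 jw] := digit_exists wI.
have [[TI _ Tg _] zE zt] := generic_branch k14 kz gz.
have [_ wE wt] := generic_branch j14 jw gw.
rewrite -zw in wE wt.
have zy : z.2 = 2 / (calT alpha z).2 - k%:R by rewrite -[in LHS]zE.
have wy : w.2 = 2 / (calT alpha z).2 - j%:R by rewrite -[in LHS]wE.
rewrite zy in zt; rewrite wy in wt.
by rewrite -zE -wE (tile_unique alphaAB TI zt wt).
Qed.

Lemma calT_bij : set_bij generic generic (calT alpha).
Proof.
split; first by move=> z; exact: calT_generic.
- by move=> z w; rewrite !inE; exact: calT_generic_inj.
- by move=> z /generic_preimage[k [_ gk _ <-]]; exists (branch_inv k%:R z).
Qed.

End natural_extension_map.

(** * The invariant measure on the plane *)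

Section planar_measure.
Context {R : realType}.
Notation MR := (measurableTypeR R).
Notation MR2 := (measurableTypeR R * measurableTypeR R)%type.
Notation leb := (@lebesgue_measure R).
Local Open Scope ereal_scope.

Definition kmeasure := dmeasure (leb2 R) measurableT measurable_kernel (@kernel_ge0 R).
HB.instance Definition _ := Measure.on kmeasure.

Lemma kmeasureE (A : set MR2) :
  kmeasure A = \int[leb2 R]_(z in A) (kernel z)%:E.
Proof. by rewrite /kmeasure /dmeasure setTI. Qed.

Lemma kmeasure_null (A : set MR2) : measurable A -> leb2 R A = 0 -> kmeasure A = 0.
Proof.
move=> mA A0; rewrite kmeasureE; apply: null_set_integral => //.
by apply/measurable_EFinP; apply: measurable_funTS; exact: measurable_kernel.
Qed.

Lemma kmeasure_eq (A B N : set MR2) : measurable A -> measurable B -> measurable N ->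
  leb2 R N = 0 -> A `\` N = B `\` N -> kmeasure A = kmeasure B.
Proof.
move=> mA mB mN N0 AB.
have h (C : set MR2) : measurable C -> kmeasure C = kmeasure (C `\` N).
  move=> mC; have -> : kmeasure C = kmeasure (C `\` N) + kmeasure (C `&` N).
    exact: measureDI.
  rewrite [X in _ + X]kmeasure_null ?adde0//; first exact: measurableI.
  apply: (@subset_measure0 _ _ _ (leb2 R) _ N) => //; exact: measurableI.
by rewrite (h A)// (h B)// AB.
Qed.

Definition lines (O : set R) : set MR2 := [set z | O z.1 \/ O z.2].

Lemma countable_measurableR (O : set R) : countable O -> measurable (O : set MR).
Proof. by apply: countable_measurable => t; exact: measurable_set1. Qed.

Lemma linesE (O : set R) : lines O = (O `*` setT) `|` (setT `*` O).
Proof.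
by apply/seteqP; split=> -[x y] /=; rewrite /lines /=; tauto.
Qed.

Lemma measurable_lines (O : set R) : countable O -> measurable (lines O).
Proof.
move=> /countable_measurableR mO; rewrite linesE.
by apply: measurableU; exact: measurableX.
Qed.

Lemma leb2_line (O : set R) : countable O -> leb2 R (O `*` setT) = 0.
Proof.
move=> cO; transitivity (leb O * leb setT).
  by apply: product_measure1E => //; exact: countable_measurableR.
by rewrite [X in X * _]countable_lebesgue_measure0// mul0e.
Qed.

Lemma leb2_line_r (O : set R) : countable O -> leb2 R (setT `*` O) = 0.
Proof.
move=> cO; transitivity (leb setT * leb O).
  by apply: product_measure1E => //; exact: countable_measurableR.
by rewrite [X in _ * X]countable_lebesgue_measure0// mule0.
Qed.

Lemma leb2_lines (O : set R) : countable O -> leb2 R (lines O) = 0.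
Proof.
move=> cO; have mO := countable_measurableR cO.
apply/eqP; rewrite eq_le measure_ge0 andbT linesE.
apply: (le_trans (measureU2 _ _ _)); try exact: measurableX.
by rewrite [X in X + _]leb2_line// [X in _ + X]leb2_line_r// adde0.
Qed.

Lemma measurable_lt_set (f g : MR2 -> R) : measurable_fun setT f ->
  measurable_fun setT g -> measurable [set z | (f z < g z)%R].
Proof.
move=> mf mg; rewrite -[X in measurable X]setTI.
exact: (measurable_fun_ltr mf mg measurableT (Y := [set true])).
Qed.

Lemma measurable_le_set (f g : MR2 -> R) : measurable_fun setT f ->
  measurable_fun setT g -> measurable [set z | (f z <= g z)%R].
Proof.
move=> mf mg; rewrite -[X in measurable X]setTI.
exact: (measurable_fun_ler mf mg measurableT (Y := [set true])).
Qed.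

End planar_measure.

Section planar_invariance.
Context {R : realType}.
Notation MR := (measurableTypeR R).
Notation MR2 := (measurableTypeR R * measurableTypeR R)%type.
Variable alpha : R.
Hypothesis alphaAB : cA R < alpha < cB R.
Variables (S : set R) (finS : finite_set S).

Local Notation low := (low alpha).
Local Notation upp := (upp alpha).
Local Notation exc := (exceptional alpha S).
Local Notation orb := (moebius_orbit exc).
Local Notation generic := (generic alpha S).
Local Open Scope ereal_scope.

Lemma exceptional_finite : finite_set exc.
Proof. by rewrite finite_setU; split => //; exact: finite_seq. Qed.

Lemma orbit_countable : countable orb.
Proof. exact/moebius_orbit_countable/finite_set_countable/exceptional_finite. Qed.

Lemma measurable_low : measurable_fun [set: MR] (low : MR -> R).
Proof.
rewrite /low; apply: measurable_fun_if => //.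
  by apply: measurable_fun_ltr => //; exact: measurable_cst.
apply: measurable_funTS; apply: measurable_fun_if => //.
by apply: measurable_fun_ltr => //; exact: measurable_cst.
Qed.

Lemma measurable_upp : measurable_fun [set: MR] (upp : MR -> R).
Proof.
rewrite /upp; apply: measurable_fun_if => //.
  by apply: measurable_fun_ltr => //; exact: measurable_cst.
apply: measurable_funTS; apply: measurable_fun_if => //.
by apply: measurable_fun_ltr => //; exact: measurable_cst.
Qed.

Definition region : set MR2 :=
  [set z | (alpha <= z.1 <= alpha + 1)%R /\ (low z.1 <= z.2 <= upp z.1)%R].

Lemma measurable_region : measurable region.
Proof.
have -> : region = [set z : MR2 | (alpha <= z.1)%R] `&` [set z : MR2 | (z.1 <= alpha + 1)%R]
   `&` ([set z : MR2 | (low z.1 <= z.2)%R] `&` [set z : MR2 | (z.2 <= upp z.1)%R]).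
  by apply/seteqP; split => z; rewrite /region /= => -[]; [move=> /andP[-> ->] /andP[-> ->]
    |move=> [-> ->] [-> ->]].
by repeat apply: measurableI; apply: measurable_le_set => //;
  (try exact: measurable_fst); (try exact: measurable_snd);
  apply: measurableT_comp; (try exact: measurable_low);
  (try exact: measurable_upp); exact: measurable_fst.
Qed.

Lemma region_generic : region `\` lines orb = generic.
Proof.
have exc_orb x : exc x -> orb x by exact: moebius_orbit_sub.
apply/seteqP; split => z /=.
  move=> [[/andP[z1 z2] /andP[zl zu]]] /not_orP[g1 g2].
  have neq x c : ~ orb x -> c \in [:: alpha; (alpha + 1)%R; bTa alpha; bTb alpha;
      bTTa alpha; bTTb alpha; cA R; cB R; cC R; cD R; cE R; cF R] -> x != c.
    by move=> xg cl; apply/eqP => xc; apply: xg; rewrite xc; apply: exc_orb; right.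
  split=> //; rewrite lt_neqAle.
    rewrite z1 andbT eq_sym neq ?inE ?eqxx//=.
    by rewrite lt_neqAle z2 andbT neq// !inE eqxx orbT.
  rewrite zl andbT lt_neqAle zu andbT; apply/andP; split.
    rewrite eq_sym; apply: neq => //; rewrite /low !inE.
    by do 2 ?case: ifP => _; rewrite eqxx ?orbT.
  by apply: neq => //; rewrite /upp !inE; do 2 ?case: ifP => _; rewrite eqxx ?orbT.
move=> [/andP[z1 z2] /andP[zl zu] g1 g2]; split; last by case.
by split; rewrite !ltW.
Qed.

Lemma measurable_generic : measurable (generic : set MR2).
Proof.
rewrite -region_generic; apply: measurableD; first exact: measurable_region.
by apply: measurable_lines; exact: orbit_countable.
Qed.

Lemma measurable_calT : measurable_fun [set: MR2] (calT alpha : MR2 -> MR2).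
Proof.
apply: measurable_fun_pair.
  by apply: (measurableT_comp (@measurable_T R alpha)); exact: measurable_fst.
apply: measurable_funM => //; apply: (measurableT_comp (@measurable_inv R)).
apply: measurable_funD; last exact: measurable_snd.
apply: (measurableT_comp (@measurable_floor R)); apply: measurable_funB => //.
apply: measurable_funM => //; apply: (measurableT_comp (@measurable_inv R)).
exact: measurable_fst.
Qed.

(** The points of digit [k] are mapped by an inverse of [branch_inv k], which
    preserves [kmeasure], and the map is a bijection of the generic points. *)
Lemma kmeasure_invariant (E : set MR2) : measurable E ->
  kmeasure (generic `&` calT alpha @^-1` E) = kmeasure (generic `&` E).
Proof.
move=> mE; have a0 := alpha_gt0 alphaAB.
pose G (k : nat) : set MR2 := [set z | (1 <= k <= 4)%N /\ in_branch alpha k z.1] `&`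
  (generic `&` calT alpha @^-1` E).
pose F (k : nat) : set MR2 :=
  [set z | [/\ - k%:R < z.1, 0 < z.2 & G k (branch_inv k%:R z)]%R].
have mT : measurable (calT alpha @^-1` E : set MR2).
  by apply: measurable_preimage mE; exact: measurable_calT.
have mG k : measurable (G k).
  apply: measurableI; last by apply: measurableI => //; exact: measurable_generic.
  have [k14|k14] := boolP (1 <= k <= 4)%N; last first.
    by rewrite (_ : [set _ | _] = set0)//; apply/seteqP; split => z //= [].
  have mb : measurable_fun [set: MR2] (fun z : MR2 => 2 / z.1 - k%:R)%R.
    apply: measurable_funB => //; apply: measurable_funM => //.
    apply: (measurableT_comp (@measurable_inv R)); exact: measurable_fst.
  rewrite (_ : [set _ | _] = [set z : MR2 | (alpha <= 2 / z.1 - k%:R)%R] `&`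
    [set z : MR2 | (2 / z.1 - k%:R < alpha + 1)%R]).
    by apply: measurableI; [exact: measurable_le_set|exact: measurable_lt_set].
  apply/seteqP; split => z /=; first by move=> [_ /andP[]].
  by move=> [h1 h2]; split=> //; rewrite /in_branch h1.
have G_pos k z : G k z -> (0 < z.1 /\ - k%:R < z.2)%R.
  move=> [_ [[/andP[z1 _] /andP[zl _] _ _] _]]; split; first exact: lt_trans z1.
  by rewrite (le_lt_trans _ (lt_trans (low_gt0 _ _) zl))// oppr_le0.
have mF k : measurable (F k).
  rewrite (_ : F k = [set z : MR2 | (- k%:R < z.1)%R] `&`
    ([set z : MR2 | (0 < z.2)%R] `&` (branch_inv k%:R : MR2 -> MR2) @^-1` G k)).
    apply: measurableI; first by apply: measurable_lt_set => //; exact: measurable_fst.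
    apply: measurableI; first by apply: measurable_lt_set => //; exact: measurable_snd.
    by apply: measurable_preimage (mG k); exact: measurable_branch_inv.
  by apply/seteqP; split => z /=; [case|move=> [? [? ?]]; split].
have FG k : kmeasure (F k) = kmeasure (G k).
  by rewrite !kmeasureE -integral_kernel_branch//; exact: G_pos.
have F_calT k z : F k z -> calT alpha (branch_inv k%:R z) = z.
  move=> [zk z0 [[k14 kb] [gz _]]].
  rewrite (calT_branch kb) /branch_inv /=.
  have two x : (2 / (2 / x) = x :> R)%R by rewrite invfM invrK mulrA divff// mul1r.
  by rewrite two addrAC subrr add0r addrC subrK two; case: (z).
have UG : \bigcup_k G k = generic `&` calT alpha @^-1` E.
  apply/seteqP; split => z; first by move=> [k _ [_]].
  move=> [gz Ez]; have [zI _ _ _] := gz.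
  by have [k k14 kz] := digit_exists alphaAB zI; exists k.
have UF : \bigcup_k F k = generic `&` E.
  apply/seteqP; split => z.
    move=> [k _ Fz]; rewrite -(F_calT k z Fz); have [zk z0 [_ [gz Ez]]] := Fz.
    by split => //; exact: calT_generic.
  move=> [gz Ez]; have [k [k14 gk kb kT]] := generic_preimage alphaAB gz.
  have [/andP[z1 _] /andP[z2 _] _ _] := gz.
  exists k => //; split.
  - by rewrite (le_lt_trans _ (lt_trans a0 z1))// oppr_le0.
  - exact: lt_trans (low_gt0 _ _) z2.
  - by split => //; split => //=; rewrite kT.
have tG : trivIset setT G.
  apply/trivIsetP => j k _ _ jk; apply/seteqP; split => z //= [[[_ jz] _] [[_ kz] _]].
  by move: jk; rewrite (in_branch_inj jz kz) eqxx.
have tF : trivIset setT F.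
  apply/trivIsetP => j k _ _ jk; apply/seteqP; split => z //= [Fj Fk].
  have ej := F_calT j z Fj; have ek := F_calT k z Fk.
  have [_ _ [[_ jz] [gj _]]] := Fj; have [_ _ [[_ kz] [gk _]]] := Fk.
  have e : branch_inv j%:R z = branch_inv k%:R z.
    by apply: (calT_generic_inj alphaAB gj gk); rewrite ej ek.
  by move: jk; rewrite e in jz; rewrite (in_branch_inj jz kz) eqxx.
rewrite -UG -UF !measure_semi_bigcup//.
- by apply: eq_eseriesr => k _; exact/esym/FG.
- exact: bigcupT_measurable.
- exact: bigcupT_measurable.
Qed.

End planar_invariance.

(** * The density and its normalisation *)

Section logarithmic_integrals.
Context {R : realType}.
Notation MR := (measurableTypeR R).
Notation leb := (@lebesgue_measure R).
Variables (a b : R).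
Hypothesis a0 : 0 < a.
Local Notation I := (`[a, b]%classic : set MR).

Let mI : measurable I. Proof. by []. Qed.

Definition integral_is (f : R -> R) (v : R) :=
  leb.-integrable I (EFin \o f) /\ (\int[leb]_(x in I) (f x)%:E = v%:E)%E.

Lemma integral_isD f g v w : integral_is f v -> integral_is g w ->
  integral_is (fun x => f x + g x) (v + w).
Proof.
move=> [if1 fv] [ig gw]; split.
  by have := integrableD mI if1 ig.
by have := integralD_EFin mI if1 ig; rewrite /= fv gw => ->.
Qed.

Lemma integral_isB f g v w : integral_is f v -> integral_is g w ->
  integral_is (fun x => f x - g x) (v - w).
Proof.
move=> [if1 fv] [ig gw]; split.
  by have := integrableB mI if1 ig.
by have := integralB_EFin mI if1 ig; rewrite fv gw => ->.
Qed.

Lemma integral_isZ (c : R) f v : integral_is f v ->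
  integral_is (fun x => c * f x) (c * v).
Proof.
move=> [if1 fv]; split.
  by have := integrableZl mI c if1.
by have := integralZl mI if1 c; rewrite /= fv => ->.
Qed.

Variable c : R.
Hypothesis c0 : 0 < c.
Let g x := c / (2 + c * x).

Let den0 (x : R) : 0 < x -> 0 < 2 + c * x.
Proof. by move=> x0; rewrite ltr_wpDr// mulr_ge0// ltW. Qed.

Let continuous_den (x : R) : {for x, continuous (fun y : R => 2 + c * y)}.
Proof.
by apply: cvgD; [exact: cvg_cst|apply: cvgM; [exact: cvg_cst|exact: cvg_id]].
Qed.

Let continuous_g (x : R) : 0 < x -> {for x, continuous g}.
Proof.
move=> x0; apply: cvgM; first exact: cvg_cst.
by apply: cvgV; [rewrite gt_eqF// den0|exact: continuous_den].
Qed.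

Let derive_g (x : R) : 0 < x -> is_derive x 1 (fun y => ln (2 + c * y)) (g x).
Proof.
move=> x0; have d1 : is_derive x 1 (fun y : R => 2 + c * y) c.
  by apply: is_derive_eq; rewrite /GRing.scale /= add0r mul1r mulr1.
have := @is_derive1_comp _ (@ln R) (fun y => 2 + c * y) x _ c
  (is_derive1_ln (den0 x0)) d1.
by rewrite mulrC.
Qed.

Lemma integral_is_log (p q r : R) : a <= p -> p < q -> q <= b -> 0 < r ->
  2 + c * q = r * (2 + c * p) ->
  integral_is (fun x => c / (2 + c * x) * \1_`]p, q[%classic x) (ln r).
Proof.
move=> ap pq qb r0 rE; have p0 : 0 < p by exact: lt_le_trans ap.
have mD : measurable (`]p, q[%classic : set MR) by [].
have gE : EFin \o (fun x => c / (2 + c * x) * \1_`]p, q[%classic x) =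
    (EFin \o g) \_ `]p, q[.
  apply/funext => x /=; rewrite patchE indicE; case: ifPn => /= _.
    by rewrite mulr1.
  by rewrite mulr0.
have ig : leb.-integrable I (EFin \o g).
  apply: continuous_compact_integrable; first exact: segment_compact.
  apply: continuous_in_subspaceT => x /set_mem/=; rewrite in_itv /= => /andP[ax _].
  by apply: continuous_g; exact: lt_le_trans ax.
have sI : I `&` `]p, q[ = `]p, q[%classic.
  apply/setIidPr => x /=; rewrite !in_itv /= => /andP[px xq].
  by rewrite (ltW (le_lt_trans ap px)) (ltW (lt_le_trans xq qb)).
split.
  rewrite gE; apply/(integrable_restrict _ mD) => //; rewrite sI.
  by apply: integrableS ig => //; rewrite -sI; exact: subIsetl.
transitivity (\int[leb]_(x in I) ((EFin \o g) \_ `]p, q[) x)%E.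
  by rewrite -gE.
rewrite -integral_mkcondr sI -(@integral_itv_bndoo _ _ _ _ true false); last first.
  apply: measurable_funTS; apply/measurable_EFinP.
  apply: measurable_funM => //; apply: (measurableT_comp (@measurable_inv R)).
  by apply: measurable_funD => //; exact: measurable_funM.
have rlog : ln (2 + c * q) - ln (2 + c * p) = ln r.
  by rewrite rE lnM ?posrE ?den0// addrK.
rewrite -rlog.
apply: (@FTC2_is_derive _ g (fun y => ln (2 + c * y)) p q) => // x /andP[px _].
  by apply: continuous_g; exact: lt_le_trans px.
by apply: derive_g; exact: lt_le_trans px.
Qed.

End logarithmic_integrals.

Section normalisation.
Context {R : realType}.

(** From [1 + x <= expR x] applied to a small fraction of the argument. *)
Lemma ln_bound (x : R) : 1286 / 1000 < x < 1288 / 1000 ->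
  245 / 1000 < ln x < 255 / 1000.
Proof.
move=> /andP[x1 x2]; have x0 : 0 < x by lra.
have sq (y s t : R) : 0 <= s -> t <= s * s -> s <= expR y -> t <= expR (2%:R * y).
  move=> s0 ts sy; rewrite expRM_natl expr2; apply: (le_trans ts).
  by apply: ler_pM.
(* Three squarings of [1 - x / 8], rounded down. *)
have low_exp : 778 / 1000 <= expR (- (245 / 1000)) :> R.
  have -> : - (245 / 1000) = 2%:R * (2%:R * (2%:R * (- (245 / 1000 / 8)))) :> R by lra.
  apply: (sq _ (882 / 1000 + 6 / 1000 / 10)); [lra|lra|].
  apply: (sq _ (939 / 1000 + 5 / 1000 / 10)); [lra|lra|].
  apply: (sq _ (969 / 1000 + 3 / 1000 / 10)); [lra|lra|].
  by apply: le_trans (expR_ge1Dx _); lra.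
(* Five squarings of [1 + x / 32], rounded down. *)
have upp_exp : 1288 / 1000 <= expR (255 / 1000) :> R.
  have -> : 255 / 1000 = 2%:R * (2%:R * (2%:R * (2%:R * (2%:R * (255 / 1000 / 32))))) :> R.
    by lra.
  apply: (sq _ (1 + 135 / 1000)); [lra|lra|].
  apply: (sq _ (1 + 65 / 1000 + 4 / 1000 / 10)); [lra|lra|].
  apply: (sq _ (1 + 32 / 1000 + 2 / 1000 / 10)); [lra|lra|].
  apply: (sq _ (1 + 15 / 1000 + 98 / 1000 / 100)); [lra|lra|].
  apply: (sq _ (1 + 796 / 1000 / 100)); [lra|lra|].
  by apply: le_trans (expR_ge1Dx _); lra.
rewrite expRN in low_exp.
apply/andP; split; rewrite -ltr_expR lnK ?posrE//; last exact: lt_le_trans upp_exp.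
apply: le_lt_trans x1.
have e0 : 0 < expR (245 / 1000 : R) by exact: expR_gt0.
have : 778 / 1000 * expR (245 / 1000) <= 1 :> R by rewrite -ler_pdivlMr// div1r.
lra.
Qed.

Local Notation A := (cA R).
Local Notation B := (cB R).

Lemma HinvE : Hinv R = ln ((5 + 2 * B) * (2 - 3 * A) / 4).
Proof.
rewrite /Hinv; congr ln.
have -> : Num.sqrt 33 = 2 * A + 5 :> R by rewrite /cA; field.
have -> : Num.sqrt 2 = B + 1 :> R by rewrite /cB; ring.
have aE := @cA_eq R; have -> : 2 - 3 * A = A ^+ 2 * (A + 6).
  by rewrite (_ : A ^+ 2 * (A + 6) = (A ^+ 2 + 5 * A) * (A + 1) - 5 * A); [rewrite aE|]; ring.
by field.
Qed.

Lemma Hinv_bounds : 245 / 1000 < Hinv R < 255 / 1000.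
Proof.
rewrite HinvE; apply: ln_bound.
have r0 : 0 <= Num.sqrt (33 : R) by exact: sqrtr_ge0.
have s0 : 0 <= Num.sqrt (2 : R) by exact: sqrtr_ge0.
have aE := @cA_eq R; have bE := @cB_eq R.
have /andP[a1 a2] := @cA_bounds R; have /andP[b1 b2] := @cB_bounds R.
have a3 : A < 372 / 1000 + 3 / 1000 / 10 by nra.
have b3 : 414 / 1000 + 2 / 1000 / 10 < B by nra.
have b4 : B < 414 / 1000 + 3 / 1000 / 10 by nra.
have a4 : 372 / 1000 + 2 / 1000 / 10 < A by nra.
by apply/andP; split; nra.
Qed.

Lemma H_gt0 : 0 < H R.
Proof. by rewrite invr_gt0; have /andP[h _] := Hinv_bounds; lra. Qed.

Variable alpha : R.
Hypothesis alphaAB : A < alpha < B.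

Local Notation bTa := (bTa alpha).
Local Notation bTb := (bTb alpha).
Local Notation bTTa := (bTTa alpha).
Local Notation bTTb := (bTTb alpha).

Let a0 := alpha_gt0 alphaAB.
Let a37 := alpha_gt a0 (alpha_A alphaAB).
Let a41 := alpha_lt (alpha_B alphaAB).

(** The six logarithms combine to a number that does not depend on [alpha]: in
    each factor the linear forms in [alpha] cancel. *)
Lemma boundary_ratios :
  [/\ 2 + cD R * bTb = (1 + B) / (1 + alpha) * (2 + cD R * alpha),
      2 + cE R * bTTa = (1 - A) * (1 + alpha) / ((3 + A) * (1 - 2 * alpha)) *
        (2 + cE R * bTb),
      2 + cF R * (alpha + 1) = (3 + B) * (1 - 2 * alpha) / (1 - B) *
        (2 + cF R * bTTa),
      2 + A * bTTb = (1 - A) / (1 - alpha) * (2 + A * alpha) &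
      2 + B * bTa = B * (1 - alpha) / ((1 - B) * alpha) * (2 + B * bTTb) /\
      2 + cC R * (alpha + 1) = (7 + A) * alpha / (2 * (A + 1)) * (2 + cC R * bTa)].
Proof.
have aE := @cA_eq R; have bE := @cB_eq R.
have /andP[a1 a2] := @cA_bounds R; have /andP[b1 b2] := @cB_bounds R.
move: a0 a37 a41 => h0 h37 h41.
have n1 : 1 + alpha != 0 by apply: lt0r_neq0; lra.
have n2 : 1 - alpha != 0 by apply: lt0r_neq0; lra.
have n3 : 1 - 2 * alpha != 0 by apply: lt0r_neq0; lra.
have n4 : alpha != 0 by apply: lt0r_neq0; lra.
have n5 : 3 + A != 0 by apply: lt0r_neq0; lra.
have n6 : 1 - B != 0 by apply: lt0r_neq0; lra.
have n7 : A + 1 != 0 by apply: lt0r_neq0; lra.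
have A2 : A ^+ 2 = 2 - 5 * A by lra.
have B2 : B ^+ 2 = 1 - 2 * B by lra.
have aA : A ^+ 2 * alpha = 2 * alpha - 5 * A * alpha by rewrite A2; ring.
have bA : B ^+ 2 * alpha = alpha - 2 * B * alpha by rewrite B2; ring.
rewrite cC_eq cD_eq cE_eq cF_eq /bTa /bTb /bTTa /bTTb.
have cross (m x y p q : R) : m != 0 -> x * m = p -> y * m = q -> p = q -> x = y.
  by move=> m0 <- <- /(mulIf m0).
repeat split.
- apply: (cross _ _ _ (2 * (1 + alpha) + 2 * B * (1 - alpha))
    ((1 + B) * (2 + 2 * B * alpha)) n1); [by field|by field|lra].
- apply: (cross _ _ _ ((3 + A) * (2 * (1 - 2 * alpha) + (A + 1) * (3 * alpha - 1)))
    ((1 - A) * (2 * (1 + alpha) + (A + 1) * (1 - alpha))) (mulf_neq0 n5 n3));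
    [by field|by field; rewrite n1 n3 n5|lra].
- apply: (cross _ _ _ ((1 - B) * (2 + (B + 1) * (alpha + 1)))
    ((3 + B) * (2 * (1 - 2 * alpha) + (B + 1) * (3 * alpha - 1))) n6);
    [by field|by field; rewrite n3 n6|lra].
- apply: (cross _ _ _ (2 * (1 - alpha) + A * (6 * alpha - 2))
    ((1 - A) * (2 + A * alpha)) n2); [by field|by field|lra].
- apply: (cross _ _ _ ((1 - B) * (2 * alpha + 2 * B - 4 * B * alpha))
    (B * (2 * (1 - alpha) + B * (6 * alpha - 2))) (mulf_neq0 n6 n4));
    [by field|by field; rewrite n2 n4 n6|lra].
- apply: (cross _ _ _ (2 * (A + 1) * (6 + (A + 1) * (alpha + 1)))
    ((7 + A) * (6 * alpha + (A + 1) * (2 - 4 * alpha)))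
    (mulf_neq0 (_ : 6 != 0) n7)); [by []|by field|by field; rewrite n4 n7|lra].
Qed.

End normalisation.

Lemma ln_six_factors (R : realType) (X x1 x2 x3 x4 x5 x6 : R) :
  0 < X -> 0 < x1 -> 0 < x2 -> 0 < x3 -> 0 < x4 -> 0 < x5 -> 0 < x6 ->
  x1 * x2 * x3 = X * x4 * x5 * x6 ->
  ln X = ln x1 + ln x2 + ln x3 - ln x4 - ln x5 - ln x6.
Proof.
move=> X0 h1 h2 h3 h4 h5 h6 /(congr1 (@ln R)).
by rewrite !lnM ?posrE ?mulr_gt0//; lra.
Qed.

Section total_mass.
Context {R : realType}.
Local Notation A := (cA R).
Local Notation B := (cB R).
Variable alpha : R.
Hypothesis alphaAB : A < alpha < B.

Local Notation bTa := (bTa alpha).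
Local Notation bTb := (bTb alpha).
Local Notation bTTa := (bTTa alpha).
Local Notation bTTb := (bTTb alpha).

Local Notation r1 := ((1 + B) / (1 + alpha)).
Local Notation r2 := ((1 - A) * (1 + alpha) / ((3 + A) * (1 - 2 * alpha))).
Local Notation r3 := ((3 + B) * (1 - 2 * alpha) / (1 - B)).
Local Notation r4 := ((1 - A) / (1 - alpha)).
Local Notation r5 := (B * (1 - alpha) / ((1 - B) * alpha)).
Local Notation r6 := ((7 + A) * alpha / (2 * (A + 1))).

Let rough : [/\ 0 < A < 1 / 2, 0 < B < 1 / 2 & 0 < alpha < 1 / 2].
Proof.
have /andP[a1 a2] := @cA_bounds R; have /andP[b1 b2] := @cB_bounds R.
by case/andP: alphaAB => h1 h2; split; apply/andP; split; lra.
Qed.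

Let ratios_gt0 : [/\ 0 < r1, 0 < r2, 0 < r3 & 0 < r4 /\ 0 < r5 /\ 0 < r6].
Proof.
have [/andP[a0 a1] /andP[b0 b1] /andP[h0 h1]] := rough.
have f1 : 0 < 1 + B by lra.
have f2 : 0 < 1 + alpha by lra.
have f3 : 0 < 1 - A by lra.
have f4 : 0 < 3 + A by lra.
have f5 : 0 < 1 - 2 * alpha by lra.
have f6 : 0 < 3 + B by lra.
have f7 : 0 < 1 - B by lra.
have f8 : 0 < 1 - alpha by lra.
have f9 : 0 < 7 + A by lra.
have f10 : 0 < A + 1 by lra.
by repeat split; rewrite ?divr_gt0 ?mulr_gt0.
Qed.

Let Hinv_log : Hinv R = ln r1 + ln r2 + ln r3 - ln r4 - ln r5 - ln r6.
Proof.
have [q1 q2 q3 [q4 [q5 q6]]] := ratios_gt0.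
have X0 : 0 < (5 + 2 * B) * (2 - 3 * A) / 4 :> R.
  have [/andP[a0 a1] /andP[b0 b1] _] := rough.
  by rewrite divr_gt0// mulr_gt0//; lra.
have product : r1 * r2 * r3 = (5 + 2 * B) * (2 - 3 * A) / 4 * r4 * r5 * r6.
  have [/andP[a0 a1] /andP[b0 b1] /andP[h0 h1]] := rough.
  have e1 : 5 + 2 * B = (1 + B) * (3 + B) / (2 * B).
    apply: (canRL (mulfK _)); first by apply: lt0r_neq0; lra.
    by have := @cB_eq R; lra.
  have e2 : 2 - 3 * A = 16 * (A + 1) / ((3 + A) * (7 + A)).
    apply: (canRL (mulfK _)); first by apply: lt0r_neq0; apply: mulr_gt0; lra.
    have aE := @cA_eq R.
    have : (A ^+ 2 + 5 * A) * A = 2 * A by rewrite aE.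
    by lra.
  rewrite e1 e2; field.
  by repeat (apply/andP; split); apply: lt0r_neq0; lra.
by rewrite HinvE; apply: (ln_six_factors X0 q1 q2 q3 q4 q5 q6).
Qed.

Lemma density_integral_is : integral_is alpha (alpha + 1) (density alpha) 1.
Proof.
have [e1 e2 e3 e4 [e5 e6]] := boundary_ratios alphaAB.
have [q1 q2 q3 [q4 [q5 q6]]] := ratios_gt0.
have [TaE TbE TTaE TTbE] := break_points_T alphaAB.
have [p1 p2 p3 p4 [p5 p6]] := break_points_order alphaAB.
have [c1 c2 c3 c4 [c5 c6]] := @constants_order R.
have h0 := alpha_gt0 alphaAB.
have Hi0 : Hinv R != 0.
  by apply: lt0r_neq0; rewrite -invr_gt0; exact: H_gt0.
have b1 : bTb < alpha + 1 by exact: lt_trans p3.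
have b2 : alpha < bTTa by exact: lt_trans p2.
have b3 : bTTb < alpha + 1 by exact: lt_trans p6.
have b4 : alpha < bTa by exact: lt_trans p5.
have B0 : 0 < B by exact: lt_trans c2.
have C0 : 0 < cC R by exact: lt_trans c3.
have D0 : 0 < cD R by exact: lt_trans c4.
have E0 : 0 < cE R by exact: lt_trans c5.
have F0 : 0 < cF R by exact: lt_trans c6.
have one : (Hinv R)^-1 * (ln r1 + ln r2 + ln r3 - ln r4 - ln r5 - ln r6) = 1.
  by rewrite -Hinv_log mulVf.
rewrite -[X in integral_is _ _ _ X]one /density TaE TbE TTaE TTbE.
apply: integral_isZ.
apply: integral_isB; last by apply: integral_is_log => //; exact: ltW.
apply: integral_isB; last by apply: integral_is_log => //; exact: ltW.
apply: integral_isB; last by apply: integral_is_log => //; exact: ltW.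
apply: integral_isD; last by apply: integral_is_log => //; exact: ltW.
by apply: integral_isD; apply: integral_is_log => //; exact: ltW.
Qed.

End total_mass.

(** * Marginals *)

Section marginal.
Context {R : realType}.
Notation MR := (measurableTypeR R).
Notation MR2 := (measurableTypeR R * measurableTypeR R)%type.
Notation leb := (@lebesgue_measure R).
Local Open Scope ereal_scope.

Lemma kernel_slice (x a b : R) : (0 < x)%R -> (0 <= a)%R -> (a < b)%R ->
  \int[leb]_(y in `[a, b]) (kernel (x, y))%:E =
  (b / (2 + b * x) - a / (2 + a * x))%:E.
Proof.
move=> x0 a0 ab.
have den0 (y : R) : (a <= y)%R -> (2 + x * y != 0)%R.
  by move=> ay; rewrite gt_eqF// ltr_wpDr// mulr_ge0 ?(ltW x0)// (le_trans a0).
have cden (y : R) : {for y, continuous (fun t : R => 2 + x * t)%R}.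
  by apply: cvgD; [exact: cvg_cst|apply: cvgM; [exact: cvg_cst|exact: cvg_id]].
rewrite ![(_ * x)%R]mulrC.
apply: (@FTC2_is_derive _ (fun y => kernel (x, y)) (fun y => y / (2 + x * y))%R) => //
  y /andP[ay _].
  apply: cvgM; first exact: cvg_cst.
  apply: cvgV; first by rewrite expf_neq0// den0.
  apply: (@continuous_comp _ _ _ (fun t : R => 2 + x * t)%R (fun t : R => t ^+ 2)%R).
    exact: cden.
  exact: exprn_continuous.
have d1 : is_derive y 1%R (fun t : R => 2 + x * t)%R x.
  by apply: is_derive_eq; rewrite /GRing.scale /= add0r mul1r mulr1.
have d2 := @is_deriveV _ (fun t : R => 2 + x * t)%R y x 1%R (den0 y ay) d1.
apply: is_derive_eq; rewrite /GRing.scale /= /kernel /=.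
by field; exact: den0.
Qed.

Variable alpha : R.
Hypothesis alphaAB : (cA R < alpha < cB R)%R.

Local Notation low := (low alpha).
Local Notation upp := (upp alpha).
Local Notation I := (`[alpha, (alpha + 1)%R]%classic : set MR).

Definition fibre_density (x : R) : R :=
  upp x / (2 + upp x * x) - low x / (2 + low x * x).

Lemma kmeasure_marginal (E : set MR) : measurable E ->
  kmeasure (region alpha `&` fst @^-1` E) =
  \int[leb]_(x in I `&` E) (fibre_density x)%:E.
Proof.
move=> mE; have a0 := alpha_gt0 alphaAB.
have mA : measurable (region alpha `&` fst @^-1` E : set MR2).
  apply: measurableI; first exact: measurable_region.
  by apply: measurable_preimage mE; exact: measurable_fst.
pose f : MR2 -> \bar R :=
  (fun z => (kernel z)%:E) \_ (region alpha `&` fst @^-1` E).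
have mf : measurable_fun setT f.
  apply/(measurable_restrictT _ _).1 => //; apply: measurable_funTS.
  by apply/measurable_EFinP; exact: measurable_kernel.
have f0 z : 0 <= f z.
  by apply: erestrict_ge0 => {}z _; rewrite lee_fin kernel_ge0.
rewrite kmeasureE integral_mkcond /leb2 -/f fubini_tonelli1//.
rewrite [RHS]integral_mkcond; apply: eq_integral => x _.
rewrite patchE /fubini_F; case: ifPn => [|xI]; last first.
  apply: integral0_eq => y _; rewrite /f patchE memNset//.
  move=> [[/= xI' _] Ex]; move/negP: xI; apply; rewrite inE.
  by split; [rewrite /= in_itv /=|exact: Ex].
rewrite inE => -[/= + Ex]; rewrite in_itv /= => /andP[x1 x2].
have x0 : (0 < x)%R by exact: lt_le_trans x1.
rewrite /fibre_density -kernel_slice//; last 2 first.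
- exact/ltW/low_gt0.
- exact: low_lt_upp.
rewrite [RHS]integral_mkcond; apply: eq_integral => y _; rewrite /f !patchE.
have -> : ((x, y) \in region alpha `&` fst @^-1` E) =
    (y \in `[low x, upp x]%classic).
  apply/idP/idP; rewrite !inE /= in_itv /=; first by move=> [[_ ->]].
  by move=> yl; split=> //; split; rewrite //= x1.
by [].
Qed.

Lemma density_fibre (x : R) : (alpha < x < alpha + 1)%R ->
  ~ exceptional alpha set0 x ->
  density alpha x = (H R * fibre_density x)%R.
Proof.
move=> /andP[x1 x2] gx.
have neq c : c \in [:: alpha; (alpha + 1)%R; bTa alpha; bTb alpha;
    bTTa alpha; bTTb alpha; cA R; cB R; cC R; cD R; cE R; cF R] -> x != c.
  by move=> cl; apply/eqP => xc; apply: gx; right; rewrite /= xc.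
have n1 : x != bTa alpha by apply: neq; rewrite !inE eqxx ?orbT.
have n2 : x != bTb alpha by apply: neq; rewrite !inE eqxx ?orbT.
have n3 : x != bTTa alpha by apply: neq; rewrite !inE eqxx ?orbT.
have n4 : x != bTTb alpha by apply: neq; rewrite !inE eqxx ?orbT.
have [TaE TbE TTaE TTbE] := break_points_T alphaAB.
have [p1 p2 p3 p4 [p5 p6]] := break_points_order alphaAB.
rewrite /density TaE TbE TTaE TTbE /fibre_density /low /upp !indicE.
rewrite !mem_setE !in_itv /= x1 x2 /= !andbT.
congr (_ * _)%R.
have -> : (cD R / (2 + cD R * x) * (x < bTb alpha)%R%:R +
   cE R / (2 + cE R * x) * ((bTb alpha < x) && (x < bTTa alpha))%R%:R +
   cF R / (2 + cF R * x) * (bTTa alpha < x)%R%:R =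
   (if x < bTb alpha then cD R else if x < bTTa alpha then cE R else cF R) /
   (2 + (if x < bTb alpha then cD R else if x < bTTa alpha then cE R else cF R) * x))%R.
  case: (ltgtP x (bTb alpha)) n2 => // xb _ /=.
    have xbb : (x < bTTa alpha)%R by exact: lt_trans p2.
    by rewrite (lt_gtF xbb) !mulr0 !addr0 mulr1.
  by case: (ltgtP x (bTTa alpha)) n3 => // xbb _ /=;
    rewrite !mulr0 ?mulr1 ?add0r ?addr0.
rewrite -!addrA -!opprD !addrA; congr (_ - _)%R.
case: (ltgtP x (bTTb alpha)) n4 => // xb _ /=.
  have xbb : (x < bTa alpha)%R by exact: lt_trans p5.
  by rewrite (lt_gtF xbb) !mulr0 !addr0 mulr1.
by case: (ltgtP x (bTa alpha)) n1 => // xbb _ /=;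
  rewrite !mulr0 ?mulr1 ?add0r ?addr0.
Qed.

Lemma measurable_fibre_density : measurable_fun [set: MR] fibre_density.
Proof.
have mq (q : MR -> R) : measurable_fun [set: MR] q ->
    measurable_fun [set: MR] (fun x => q x / (2 + q x * x))%R.
  move=> mq; apply: measurable_funM => //.
  apply: (measurableT_comp (@measurable_inv R)).
  by apply: measurable_funD => //; exact: measurable_funM.
by apply: measurable_funB; apply: mq; [exact: measurable_upp|exact: measurable_low].
Qed.

Lemma integral_density (E : set MR) : measurable E ->
  \int[leb]_(x in I `&` E) (density alpha x)%:E =
  (H R)%:E * kmeasure (region alpha `&` fst @^-1` E).
Proof.
move=> mE; rewrite kmeasure_marginal//.
have mI : measurable (I `&` E : set MR) by exact: measurableI.
have a0 := alpha_gt0 alphaAB.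
have fd0 x : I x -> (0 <= fibre_density x)%R.
  rewrite /= in_itv /= => /andP[x1 _]; have x0 : (0 < x)%R by exact: lt_le_trans x1.
  have l0 := low_gt0 alpha x; have lu := low_lt_upp alpha x.
  have u0 := lt_trans l0 lu.
  rewrite subr_ge0 ler_pdivrMr; last by rewrite ltr_wpDr// mulr_ge0 ?ltW.
  rewrite mulrAC ler_pdivlMr; last by rewrite ltr_wpDr// mulr_ge0 ?ltW.
  by nra.
rewrite -ge0_integralZl//; last 3 first.
- by apply/measurable_EFinP; apply: measurable_funTS; exact: measurable_fibre_density.
- by move=> x [xI _]; rewrite lee_fin; exact: fd0.
- by rewrite lee_fin ltW// H_gt0.
have [idens _] := density_integral_is alphaAB.
apply: ae_eq_integral => //.
- apply: measurable_funS (measurable_int _ idens) => //.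
- apply/measurable_EFinP; apply: measurable_funTS.
  by apply: measurable_funM => //; exact: measurable_fibre_density.
exists (exceptional alpha set0); split.
- apply: countable_measurableR; apply: finite_set_countable.
  by apply: exceptional_finite; exact: finite_set0.
- apply: countable_lebesgue_measure0; apply: finite_set_countable.
  by apply: exceptional_finite; exact: finite_set0.
move=> x /= h; apply: contrapT => gx; apply: h => -[xI _].
rewrite -EFinM; congr EFin; apply: density_fibre => //.
move: xI; rewrite /= in_itv /= !le_eqVlt => /andP[/predU1P[xa|->]].
  by exfalso; apply: gx; right; rewrite /= xa !inE eqxx.
move=> /predU1P[xb|//].
by exfalso; apply: gx; right; rewrite /= xb !inE eqxx orbT.
Qed.

End marginal.

(** * The natural extension *)

Section region_of_boundaries.
Context {R : realType}.
Notation MR := (measurableTypeR R).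
Notation MR2 := (measurableTypeR R * measurableTypeR R)%type.
Variable alpha : R.
Hypothesis alphaAB : cA R < alpha < cB R.
Variables (S : set R) (l u : R -> R).
Hypotheses (finS : finite_set S) (hl : lower_boundary alpha S l).
Hypothesis hu : upper_boundary alpha S u.

Local Notation exc := (exceptional alpha S).
Local Notation orb := (moebius_orbit exc).

Lemma boundaries_generic x : alpha < x < alpha + 1 -> ~ exc x ->
  l x = low alpha x /\ u x = upp alpha x.
Proof.
move=> /andP[x1 x2] gx.
have neq c : c \in [:: alpha; alpha + 1; bTa alpha; bTb alpha;
    bTTa alpha; bTTb alpha; cA R; cB R; cC R; cD R; cE R; cF R] -> x != c.
  by move=> cl; apply/eqP => xc; apply: gx; right; rewrite /= xc.
have n1 : x != bTa alpha by apply: neq; rewrite !inE eqxx ?orbT.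
have n2 : x != bTb alpha by apply: neq; rewrite !inE eqxx ?orbT.
have n3 : x != bTTa alpha by apply: neq; rewrite !inE eqxx ?orbT.
have n4 : x != bTTb alpha by apply: neq; rewrite !inE eqxx ?orbT.
have Sx : ~ S x by move=> Sx; apply: gx; left.
have [TaE TbE TTaE TTbE] := break_points_T alphaAB.
have [l1 l2 l3] := hl Sx; have [u1 u2 u3] := hu Sx.
rewrite TaE TTbE in l1 l2 l3; rewrite TbE TTaE in u1 u2 u3.
rewrite /low /upp; split.
  case: (ltgtP x (bTTb alpha)) n4 => // xb _; first by apply: l1; rewrite x1.
  case: (ltgtP x (bTa alpha)) n1 => // xc _; first by apply: l2; rewrite xb.
  by apply: l3; rewrite xc.
case: (ltgtP x (bTb alpha)) n2 => // xb _; first by apply: u1; rewrite x1.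
case: (ltgtP x (bTTa alpha)) n3 => // xc _; first by apply: u2; rewrite xb.
by apply: u3; rewrite xc.
Qed.

Let inside x : alpha <= x <= alpha + 1 -> ~ exc x -> alpha < x < alpha + 1.
Proof.
move=> /andP[x1 x2] gx; rewrite !lt_neqAle x1 x2 !andbT.
by apply/andP; split; apply/eqP => xe; apply: gx; right;
  rewrite /= ?xe -?xe !inE eqxx ?orbT.
Qed.

Lemma Omega_region (z : MR2) : ~ exc z.1 -> Omega alpha l u z <-> region alpha z.
Proof.
move=> gz; split=> -[zI zlu]; split=> //.
  by have [<- <-] := boundaries_generic (inside zI gz) gz.
by have [-> ->] := boundaries_generic (inside zI gz) gz.
Qed.

(** Above the finitely many exceptional abscissas the region is an arbitrary
    vertical segment; elsewhere it coincides with [region]. *)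
Lemma measurable_Omega : measurable (Omega alpha l u : set MR2).
Proof.
pose V (s : R) : set MR := [set y | (alpha <= s <= alpha + 1) && (l s <= y <= u s)].
have -> : (Omega alpha l u : set MR2) = (region alpha `\` (exc `*` setT)) `|`
    \bigcup_(s in exc) ([set s] `*` V s).
  apply/seteqP; split => z.
    move=> Oz; have [ez|ez] := pselect (exc z.1).
      right; exists z.1 => //; split => //; rewrite /V /=.
      by case: Oz => -> ->.
    by left; split; [exact/Omega_region|move=> -[]].
  move=> [[rz nz]|[s es [/= zs /andP[h1 h2]]]].
    by apply/Omega_region => // ez; apply: nz.
  by split; rewrite zs.
have fe : finite_set exc by exact: exceptional_finite.
have me : measurable (exc : set MR).
  by apply: countable_measurableR; exact: finite_set_countable.
apply: measurableU.
  by apply: measurableD; [exact: measurable_region|exact: measurableX].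
apply: fin_bigcup_measurable => // s _; apply: measurableX; first exact: measurable_set1.
rewrite /V; case: (_ <= s <= _) => /=.
  have -> : [set y | l s <= y <= u s] = `[l s, u s]%classic.
    by apply/seteqP; split => y /=; rewrite in_itv.
  exact: measurable_itv.
by rewrite (_ : [set _ | _] = set0)//; apply/seteqP; split.
Qed.

Lemma Omega_lines : Omega alpha l u `\` lines orb = generic alpha S.
Proof.
rewrite -(region_generic alpha S); apply/seteqP; split => z [Oz nz].
all: by split=> //; apply/Omega_region => // ez; apply: nz; left;
  exact: moebius_orbit_sub.
Qed.

Local Open Scope ereal_scope.

Lemma kmeasure_Omega (E : set MR2) : measurable E ->
  kmeasure (Omega alpha l u `&` E) = kmeasure (generic alpha S `&` E).
Proof.
move=> mE; apply: (@kmeasure_eq _ _ _ (lines orb)).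
- by apply: measurableI => //; exact: measurable_Omega.
- by apply: measurableI => //; exact: measurable_generic.
- by apply: measurable_lines; exact: orbit_countable.
- by apply: leb2_lines; exact: orbit_countable.
by rewrite -Omega_lines; apply/seteqP; split => z /=; tauto.
Qed.

Lemma kmeasure_Omega_region (E : set MR2) : measurable E ->
  kmeasure (Omega alpha l u `&` E) = kmeasure (region alpha `&` E).
Proof.
move=> mE; rewrite kmeasure_Omega//; apply/esym.
apply: (@kmeasure_eq _ _ _ (lines orb)).
- by apply: measurableI => //; exact: measurable_region.
- by apply: measurableI => //; exact: measurable_generic.
- by apply: measurable_lines; exact: orbit_countable.
- by apply: leb2_lines; exact: orbit_countable.
by rewrite -(region_generic alpha S); apply/seteqP; split => z /=; tauto.
Qed.

End region_of_boundaries.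

Section invariant_probability.
Context {R : realType}.
Notation MR := (measurableTypeR R).
Notation MR2 := (measurableTypeR R * measurableTypeR R)%type.
Notation leb := (@lebesgue_measure R).
Variable alpha : R.
Hypothesis alphaAB : cA R < alpha < cB R.
Variables (S : set R) (l u : R -> R).
Hypotheses (finS : finite_set S) (hl : lower_boundary alpha S l).
Hypothesis hu : upper_boundary alpha S u.

Local Notation Om := (Omega alpha l u).
Local Notation I := (`[alpha, alpha + 1]%classic : set MR).
Local Notation g := (fun z : R * R => H R * (2 / (2 + z.1 * z.2) ^+ 2)).
Local Open Scope ereal_scope.

Let mOm : measurable (Om : set MR2).
Proof. exact: measurable_Omega finS hl hu. Qed.

Let g0 z : (0 <= g z)%R.
Proof. by rewrite mulr_ge0 ?(ltW (@H_gt0 R))//; exact: kernel_ge0. Qed.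

Let mg : measurable_fun [set: MR2] g.
Proof. by apply: measurable_funM => //; exact: measurable_kernel. Qed.

Let plane (E : set MR2) : measurable E ->
  dmeasure (leb2 R) mOm mg g0 E = (H R)%:E * kmeasure (Om `&` E).
Proof.
move=> mE; rewrite /dmeasure kmeasureE -ge0_integralZl//.
- exact: measurableI.
- by apply/measurable_EFinP; apply: measurable_funTS; exact: measurable_kernel.
- by move=> z _; rewrite lee_fin kernel_ge0.
- by rewrite lee_fin ltW// H_gt0.
Qed.

Let mfst (E : set MR) : measurable E -> measurable (fst @^-1` E : set MR2).
Proof. by move=> mE; apply: measurable_preimage mE; exact: measurable_fst. Qed.

Let plane_fst (E : set MR) : measurable E ->
  dmeasure (leb2 R) mOm mg g0 (fst @^-1` E) =
  \int[leb]_(x in I `&` E) (density alpha x)%:E.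
Proof.
move=> mE; rewrite plane; last exact: mfst.
rewrite (kmeasure_Omega_region alphaAB finS hl hu); last exact: mfst.
by rewrite integral_density.
Qed.

(** Everything about the plane reduces to [kmeasure] on the generic points;
    normalising by [H] gives mass one because the density integrates to one. *)
Lemma invariant_probabilities : exists (P : probability MR2 R) (mu : probability MR R),
  [/\ has_density (leb2 R) Om P g, preserves P Om (calT alpha),
      forall E : set MR, measurable E -> P (fst @^-1` E) = mu E &
      has_density leb I mu (density alpha)].
Proof.
have [idens dens1] := density_integral_is alphaAB.
have mass : dmeasure (leb2 R) mOm mg g0 setT = 1.
  by rewrite -[setT](preimage_setT fst) plane_fst// setIT.
have [P PE] := probability_of_mass1 mass.
have PE' (E : set MR2) : measurable E -> P E = (H R)%:E * kmeasure (Om `&` E).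
  by move=> mE; exact: etrans (PE E) (plane mE).
have mfst' : measurable_fun [set: MR2] (fst : MR2 -> MR) by exact: measurable_fst.
pose pr : {mfun MR2 >-> MR} := HB.pack (fst : MR2 -> MR)
  (isMeasurableFun.Build _ _ _ _ _ mfst').
have mass' : pushforward P pr setT = 1.
  by rewrite /pushforward preimage_setT probability_setT.
have [mu muE] := probability_of_mass1 mass'.
exists P, mu; split.
- split; last by move=> E mE; rewrite PE.
  apply/integrableP; split.
    by apply/measurable_EFinP; apply: measurable_funTS.
  under eq_integral do rewrite /= ger0_norm//.
  rewrite -[X in integral _ X _]setIT -/(dmeasure (leb2 R) mOm mg g0 setT).
  by rewrite mass ltry.
- have POm : P Om = 1.
    apply: etrans (PE Om) _; apply: etrans _ mass.
    transitivity (\int[leb2 R]_(z in Om `&` Om) (g z)%:E); first by [].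
    by rewrite setIid -[X in integral _ X _]setIT.
  split=> //.
    by apply: measurable_funTS; exact: measurable_calT.
  move=> E mE; have mTE : measurable (calT alpha @^-1` E : set MR2).
    by apply: measurable_preimage mE; exact: measurable_calT.
  rewrite !PE'//; last exact: measurableI.
  rewrite setIA setIid; congr (_ * _).
  rewrite !(kmeasure_Omega alphaAB finS hl hu)//.
  exact: kmeasure_invariant.
- by move=> E mE; rewrite muE.
- split=> // E mE; rewrite muE /pushforward.
  exact: etrans (PE _) (plane_fst mE).
Qed.

End invariant_probability.

Theorem theorem3p2 (R : realType) (alpha : R)
    (halpha : (Num.sqrt 33 - 5) / 2 < alpha < Num.sqrt 2 - 1)
    (S : set R) (l u : R -> R) (finS : finite_set S)
    (hl : lower_boundary alpha S l) (hu : upper_boundary alpha S u) :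
  exists mu : probability (measurableTypeR R) R,
    [/\ is_the_invariant_measure alpha mu,
        natural_extension (Omega alpha l u) (calT alpha) (T alpha) mu,
        has_density (@lebesgue_measure R) `[alpha, alpha + 1] mu
          (density alpha)
      & `|Hinv R - 25 / 100| < 5 / 1000].
Proof.
have alphaAB : cA R < alpha < cB R by [].
have [P [mu [densP presP margin densmu]]] := invariant_probabilities alphaAB finS hl hu.
have [mOm POm _ inv] := presP.
have mI : measurable (`[alpha, alpha + 1]%classic : set (measurableTypeR R)) by [].
have acmu : acip alpha mu.
  split.
    split=> //.
    - rewrite -margin//; apply/eqP; rewrite eq_le probability_le1 /=; last first.
        by apply: measurable_preimage mI; exact: measurable_fst.
      rewrite -POm; apply: le_measure; rewrite ?inE//.
        by apply: measurable_preimage mI; exact: measurable_fst.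
      by move=> z [+ _]; rewrite /= in_itv.
    - by apply: measurable_funTS; exact: measurable_T.
    - move=> E mE.
      have mTE : measurable (T alpha @^-1` E : set (measurableTypeR R)).
        by apply: measurable_preimage mE; exact: measurable_T.
      rewrite -!margin//; last exact: measurableI.
      have mf (F : set (measurableTypeR R)) : measurable F ->
          measurable (fst @^-1` F : set (measurableTypeR R * measurableTypeR R)).
        by move=> mF; apply: measurable_preimage mF; exact: measurable_fst.
      have POmE (F : set (measurableTypeR R * measurableTypeR R)) :
          measurable F -> P F = P (Omega alpha l u `&` F).
        move=> mF; have PC : P (~` Omega alpha l u) = 0%E.
          by rewrite probability_setC// POm subee.
        have -> : P F = (P (F `\` Omega alpha l u) + P (F `&` Omega alpha l u))%E.
          exact: measureDI.
        have -> : P (F `\` Omega alpha l u) = 0%E.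
          apply: (@subset_measure0 _ _ _ P _ (~` Omega alpha l u)) => //.
          - exact: measurableD.
          - exact: measurableC.
        by rewrite add0e setIC.
      rewrite POmE; last by apply: mf; exact: measurableI.
      rewrite -[RHS]inv; last exact: mf.
      congr (P _); apply/seteqP; split => z [Oz]; first by move=> [_ ?]; split.
      by move=> Ez; split=> //; split=> //; case: Oz => zI _; rewrite /= in_itv.
  apply/null_content_dominatesP => E mE E0; have [idens ->] := densmu => //.
  apply: null_set_integral.
  - exact: measurableI.
  - by apply: measurable_funS (measurable_int _ idens) => //; exact: mI.
  - apply: (@subset_measure0 _ _ _ lebesgue_measure _ E) => //.
    exact: measurableI.
exists mu; split => //.
- split=> // nu acnu E mE.
  exact: (acip_unique (alpha_gt0 alphaAB) (alpha_A alphaAB) (alpha_B alphaAB)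
    acmu acnu mE).
- split; last by exists (H R), P.
  exists (lines (moebius_orbit (exceptional alpha S))); split.
    apply/negligibleP.
      by apply: measurable_lines; exact: orbit_countable.
    by apply: leb2_lines; exact: orbit_countable.
  by rewrite (Omega_lines alphaAB hl hu); exact: calT_bij.
- have /andP[h1 h2] := @Hinv_bounds R.
  by rewrite ltr_norml; apply/andP; split; lra.
Qed.
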